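(* Let $X$ be a pointed metric space and let $F$ be a Banach space. The mapping $f\mapsto f^t$ is a topological isomorphism from $(\mathrm{Lip}_0(X,F),\gamma\tau_\gamma)$ onto $(\mathrm{Lip}_0(X),\tau_\gamma)\,\epsilon\, F$.
   Context: $\mathbb{K}$ is $\mathbb{R}$ or $\mathbb{C}$. $(X,d)$ is a metric space with a distinguished base point $0$. For a Banach space $F$, $\mathrm{Lip}_0(X,F)$ is the Banach space of all Lipschitz maps $f\colon X\to F$ with $f(0)=0$, with norm $\mathrm{Lip}(f)=\sup\{\|f(x)-f(y)\|/d(x,y)\colon x,y\in X,\ x\ne y\}$; $\mathrm{Lip}_0(X)=\mathrm{Lip}_0(X,\mathbb{K})$, with closed unit ball $B_{\mathrm{Lip}_0(X)}$. $\tau_0$ is the compact-open topology on $\mathrm{Lip}_0(X)$ (uniform convergence on compact subsets of $X$). $\tau_\gamma$ is the mixed topology $\gamma[\mathrm{Lip},\tau_0]$ on $\mathrm{Lip}_0(X)$: the locally convex topology having as a base of neighborhoods of zero the sets $\gamma(U)=\bigcup_{n=1}^\infty\left(U_1\cap B_{\mathrm{Lip}_0(X)}+U_2\cap 2B_{\mathrm{Lip}_0(X)}+\cdots+U_n\cap 2^{n-1}B_{\mathrm{Lip}_0(X)}\right)$, where $U=\{U_n\}$ ranges over sequences of convex balanced $\tau_0$-neighborhoods of zero. Let $\widetilde X=\{(x,y)\in X^2\colon x\ne y\}$. The topology $\gamma\tau_\gamma$ on $\mathrm{Lip}_0(X,F)$ is the locally convex topology generated by the seminorms $q(f)=\sup_{n}\alpha_n\frac{\|f(x_n)-f(y_n)\|}{d(x_n,y_n)}$,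 where $\{\alpha_n\}$ ranges over sequences in $\mathbb{R}^+$ tending to zero and $\{(x_n,y_n)\}$ over sequences in $\widetilde X$. For $f\in\mathrm{Lip}_0(X,F)$, the Lipschitz transpose $f^t\colon F'\to\mathrm{Lip}_0(X)$ is the linear map $f^t(\psi)=\psi\circ f$, where $F'$ is the dual of $F$. For locally convex Hausdorff spaces $E,F$, $F'_c$ is the dual $F'$ with the topology of uniform convergence on convex balanced compact subsets of $F$, and the $\epsilon$-product $E\,\epsilon\,F$ is the space $\mathcal{L}(F'_c;E)$ of continuous linear maps $F'_c\to E$ with the topology of uniform convergence on equicontinuous subsets of $F'$ (norm bounded subsets of $F'$ when $F$ is normed). *)

(* Defs.v *)
From HB Require Import structures.
From mathcomp Require Import all_boot all_order all_algebra.
From mathcomp Require Import all_classical all_reals.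
From mathcomp Require Import interval_inference topology normedtype sequences.
From mathcomp Require Import convex complex.

Set Implicit Arguments.
Unset Strict Implicit.
Unset Printing Implicit Defensive.

Import Order.TTheory GRing.Theory Num.Theory.
Import numFieldNormedType.Exports.

Local Open Scope classical_set_scope.
Local Open Scope ring_scope.

Variant scalar_kind := RealScalars | ComplexScalars.

Definition scalar_field (R : realType) (k : scalar_kind) : numFieldType :=
  match k with RealScalars => R | ComplexScalars => R[i]%C end.

Definition real_part (R : realType) (k : scalar_kind) : scalar_field R k -> R :=
  match k return scalar_field R k -> R with
  | RealScalars => fun a => a
  | ComplexScalars => fun a => complex.Re a
  end.
Arguments real_part {R k} a.

Definition of_real (R : realType) (k : scalar_kind) : R -> scalar_field R k :=
  match k return R -> scalar_field R k with
  | RealScalars => fun a => a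
  | ComplexScalars => fun a => (a%:C)%C
  end.

(* The library norm over R[i] takes values in R[i]; [rnorm] is the same norm
   with values in R. *)
Definition rnorm (R : realType) (k : scalar_kind)
  (V : normedModType (scalar_field R k)) (v : V) : R := real_part `|v|.

Section scalar_lemmas.
Context {R : realType} {k : scalar_kind}.
Local Notation K := (scalar_field R k).
Implicit Types a b : K.

Lemma real_partD a b : real_part (a + b) = real_part a + real_part b.
Proof. by move: a b; case: k => //= -[? ?] [? ?]. Qed.

Lemma real_part_le a b : a <= b -> real_part a <= real_part b.
Proof. by move: a b; case: k => //= -[? ?] [? ?]; rewrite lecE => /andP[]. Qed.

Lemma real_part_lt a b : a < b -> real_part a < real_part b.
Proof. by move: a b; case: k => //= -[? ?] [? ?]; rewrite ltcE => /andP[]. Qed.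

Lemma real_part0 : real_part (0 : K) = 0.
Proof. by case: k. Qed.

Lemma real_part1 : real_part (1 : K) = 1.
Proof. by case: k. Qed.

Lemma real_part_ge0 a : 0 <= a -> 0 <= real_part a.
Proof. by move/real_part_le; rewrite real_part0. Qed.

Lemma real_partM a b : 0 <= a -> real_part (a * b) = real_part a * real_part b.
Proof.
move: a b; case: k => //= -[a a'] [b b']; rewrite lecE /= => /andP[/eqP-> _].
by rewrite mul0r subr0.
Qed.

Lemma of_realK : cancel (@of_real R k) real_part.
Proof. by case: k. Qed.

Lemma of_real_gt0 (r : R) : 0 < r -> 0 < of_real k r.
Proof. by case: k => //= r0; rewrite ltcR. Qed.

Lemma real_partK a : 0 <= a -> of_real k (real_part a) = a.
Proof.
by move: a; case: k => //= -[a a']; rewrite lecE /= => /andP[/eqP-> _].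
Qed.

Lemma of_real_lt (r s : R) : r < s -> of_real k r < of_real k s.
Proof. by case: k => //= rs; rewrite ltcR. Qed.

Lemma normK_lt a (e : R) : real_part `|a| < e -> `|a| < of_real k e.
Proof. by move=> /of_real_lt; rewrite real_partK. Qed.

Context {V : normedModType K}.
Implicit Types u v : V.

Lemma rnorm_ge0 v : 0 <= rnorm v. Proof. exact/real_part_ge0. Qed.

Lemma rnorm0 : rnorm (0 : V) = 0. Proof. by rewrite /rnorm normr0 real_part0. Qed.

Lemma rnormD u v : rnorm (u + v) <= rnorm u + rnorm v.
Proof. by rewrite /rnorm -real_partD; exact/real_part_le/ler_normD. Qed.

Lemma rnormZ a v : rnorm (a *: v) = real_part `|a| * rnorm v.
Proof. by rewrite /rnorm normrZ real_partM. Qed.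

Lemma rnormN v : rnorm (- v) = rnorm v. Proof. by rewrite /rnorm normrN. Qed.

End scalar_lemmas.

Section convex_balanced.
Context {K : numFieldType} {V : lmodType K}.
Implicit Types A : set V.

Definition balanced A := forall (a : K) x, `|a| <= 1 -> A x -> A (a *: x).

Lemma convex_setE A : @convex_set K V A <->
  forall x y (t : K), 0 <= t -> t <= 1 -> A x -> A y -> A (t *: x + (1 - t) *: y).
Proof.
split=> [cA x y t t0 t1 Ax Ay|cA x y l /set_mem Ax /set_mem Ay].
  have t01 : Itv.spec (@Itv.num_sem K) (Itv.Real `[0%Z, 1%Z]) t.
    by rewrite /= /Itv.num_sem /= ger0_real //= in_itv /= t0 t1.
  have := cA x y (Itv.mk t01) (mem_set Ax) (mem_set Ay).
  by move/set_mem.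
by apply/mem_set; apply: (cA x y l%:num).
Qed.

End convex_balanced.

Record lc_base (R : realType) (k : scalar_kind) (V : lmodType (scalar_field R k)) :=
  LcBase {
  lc_base_sets : set_system V ;
  lc_base_neq0 : lc_base_sets !=set0 ;
  lc_base_setI : forall A B, lc_base_sets A -> lc_base_sets B ->
    exists2 C, lc_base_sets C & C `<=` A `&` B ;
  lc_base_add : forall A, lc_base_sets A ->
    exists2 B, lc_base_sets B & forall x y, B x -> B y -> A (x + y) ;
  lc_base_convex : forall A, lc_base_sets A -> @convex_set _ V A ;
  lc_base_balanced : forall A, lc_base_sets A -> balanced A ;
  lc_base_absorbing : forall A x, lc_base_sets A ->
    exists2 e : scalar_field R k, 0 < e & forall a, `|a| < e -> A (a *: x)
}.

(* [lc_space B] is V with the topology whose neighborhoods of x are the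
   supersets of the sets x + U, U in B. *)
Definition lc_space (R : realType) (k : scalar_kind)
  (V : lmodType (scalar_field R k)) (B : lc_base V) : Type := V.

Section lc_space.
Context {R : realType} {k : scalar_kind}.
Local Notation K := (scalar_field R k).
Context {V : lmodType K} (B : lc_base V).
Local Notation T := (lc_space B).
Local Notation nb := (lc_base_sets B).

HB.instance Definition _ := GRing.Lmodule.copy T V.

Definition lc_nbhs (x : T) : set_system T :=
  [set A | exists2 U, nb U & forall u, U u -> A (x + u)].

HB.instance Definition _ := hasNbhs.Build T lc_nbhs.

Lemma lc_base0 U : nb U -> U 0.
Proof.
move=> BU; have [e e0] := lc_base_absorbing 0 BU.
by move=> /(_ 0); rewrite normr0 scale0r; exact.
Qed.

Let lc_filter (x : T) : ProperFilter (nbhs x).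
Proof.
split.
  by move=> [U BU] /(_ 0); apply; exact: lc_base0.
split.
- by have [U BU] := lc_base_neq0 B; exists U.
- move=> A1 A2 [U1 B1 s1] [U2 B2 s2].
  have [C BC sC] := lc_base_setI B1 B2.
  by exists C => // u /sC[? ?]; split; [exact: s1|exact: s2].
- by move=> P Q PQ [U BU s]; exists U => // u /s/PQ.
Qed.

Let lc_singleton (x : T) (A : set T) : nbhs x A -> A x.
Proof.
by move=> [U BU s]; have := s 0 (lc_base0 BU); rewrite addr0.
Qed.

Let lc_nbhs_nbhs (x : T) (A : set T) : nbhs x A -> nbhs x (nbhs^~ A).
Proof.
move=> [U BU s]; have [W BW WU] := lc_base_add BU.
exists W => // u Wu; exists W => // w Ww.
by rewrite -addrA; exact/s/WU.
Qed.

HB.instance Definition _ :=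
  Nbhs_isNbhsTopological.Build T lc_filter lc_singleton lc_nbhs_nbhs.

Let lc_add : continuous (fun x : T * T => x.1 + x.2).
Proof.
move=> [x y] A [U BU s]; have [W BW WU] := lc_base_add BU.
exists ((fun z => W (z - x)), (fun z => W (z - y))).
  by split; exists W => // u; rewrite /= addrAC subrr add0r.
move=> [a b] /= [Wa Wb].
have := s _ (WU _ _ Wa Wb).
by rewrite /= addrACA !subrKC.
Qed.

Lemma lc_base_pow U n : nb U ->
  exists2 W, nb W & forall x, W x -> U (2 ^+ n *: x).
Proof.
move=> BU; elim: n => [|n [W BW WU]].
  by exists U => // x; rewrite expr0 scale1r.
have [W' BW' W'W] := lc_base_add BW.
exists W' => // x Wx; rewrite exprSr -scalerA; apply: WU.
by rewrite scaler_nat mulr2n; exact: W'W.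
Qed.

Lemma lc_base_scale U (c : K) : nb U ->
  exists2 W, nb W & forall a x, `|a| <= c -> W x -> U (a *: x).
Proof.
move=> BU.
pose n := (Num.truncn (real_part c)).+1.
have [W BW WU] := lc_base_pow n BU.
exists W => // a x ac Wx.
have n0 : (2 : K) ^+ n != 0 by rewrite expf_neq0// pnatr_eq0.
rewrite (_ : a *: x = (a / 2 ^+ n) *: (2 ^+ n *: x)); last first.
  by rewrite scalerA divfK.
apply: (lc_base_balanced BU) (WU _ Wx).
rewrite normrM normfV [`|_ ^+ _|]ger0_norm ?exprn_ge0//.
rewrite ler_pdivrMr ?exprn_gt0// mul1r.
rewrite -(real_partK (normr_ge0 a)).
have -> : (2 : K) ^+ n = of_real k (2 ^+ n).
  by case: k => //=; rewrite rmorphXn rmorph_nat.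
apply/ltW/of_real_lt; apply: (le_lt_trans (real_part_le ac)).
apply: (lt_le_trans (Num.Theory.truncnS_gt _)).
by rewrite -natrX ler_nat ltnW// ltn_expl.
Qed.

Let lc_scale : continuous (fun z : K^o * T => z.1 *: z.2).
Proof.
move=> [a x] A [U BU s]; have [W BW WU] := lc_base_add BU.
have [e e0 We] := @lc_base_absorbing _ _ V B W x BW.
have [Z BZ ZW] := lc_base_scale (`|a| + e) BW.
exists (ball a e, (fun z => Z (z - x))).
  split; first exact: nbhsx_ballx.
  by exists Z => // u; rewrite /= addrAC subrr add0r.
move=> [b y] /= []; rewrite -ball_normE /= => ab Zy.
have -> : b *: y = a *: x + ((b - a) *: x + b *: (y - x)).
  by rewrite scalerBl scalerBr addrA [a *: x + _]addrC subrK addrC subrK.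
apply/s/WU; first by apply: We; rewrite distrC.
apply: ZW => //; rewrite -[b](subrK a) addrC (le_trans (ler_normD _ _))//.
by rewrite lerD2l distrC ltW.
Qed.

Let lc_locally_convex : exists2 C : set_system T,
  (forall b, b \in C -> @convex_set K T b) & basis C.
Proof.
exists [set b | open b /\ @convex_set K T b]; first by move=> b /set_mem[].
split; first by move=> b [].
move=> x A [U BU s]; exists [set y | nbhs y [set z | U (z - x)]]; last first.
  by move=> y /nbhs_singleton /= /s; rewrite addrC subrK.
split; last by exists U => // u; rewrite /= addrAC subrr add0r.
split; first by rewrite openE => y /= /nbhs_interior.
apply/convex_setE => y z t t0 t1 [U1 BU1 s1] [U2 BU2 s2].
have [W BW WU] := lc_base_setI BU1 BU2.
exists W => // w Ww /=; have [/s1 /= h1 /s2 /= h2] := WU _ Ww.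
have /convex_setE := lc_base_convex BU => /(_ _ _ t t0 t1 h1 h2).
congr (U _); rewrite -(addrA y) -(addrA z) [t *: _]scalerDr.
by rewrite [(1 - t) *: _]scalerDr addrACA -scalerDl subrKC scale1r addrA.
Qed.

(* The library factory PreTopologicalLmod_isTvs only builds the uniform
   structure, hence the three further instances. *)
HB.instance Definition _ :=
  PreTopologicalLmod_isTvs.Build K T lc_add lc_scale lc_locally_convex.
HB.instance Definition _ :=
  PreTopologicalNmodule_isTopologicalNmodule.Build T lc_add.
HB.instance Definition _ :=
  TopologicalNmodule_isTopologicalLmodule.Build K T lc_scale.
HB.instance Definition _ := Uniform_isTvs.Build K T lc_locally_convex.

End lc_space.

Section seminorm_base.
Context {R : realType} {k : scalar_kind}.
Local Notation K := (scalar_field R k).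
Context {V : lmodType K} (Q : set (V -> R)).

Definition seminorm_sets : set_system V :=
  [set U | exists n (q : 'I_n -> V -> R) (e : R),
    [/\ forall i, Q (q i), 0 < e & U = [set v | forall i, q i v < e]]].

Hypothesis Q0 : forall q v, Q q -> 0 <= q v.
Hypothesis QD : forall q u v, Q q -> q (u + v) <= q u + q v.
Hypothesis QZ : forall q a v, Q q -> q (a *: v) <= real_part `|a| * q v.

Let seminorm_neq0 : seminorm_sets !=set0.
Proof.
exists setT, 0%N, (fun _ _ => 0), 1; split=> //; first by case.
by apply/seteqP; split=> // v _ [].
Qed.

Let seminorm_setI A B : seminorm_sets A -> seminorm_sets B ->
  exists2 C, seminorm_sets C & C `<=` A `&` B.
Proof.
move=> [n [q [e [Qq e0 ->]]]] [m [r [d [Qr d0 ->]]]].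
pose s (i : 'I_(n + m)) := match fintype.split i with inl j => q j | inr j => r j end.
exists [set v | forall i, s i v < Num.min e d].
  exists (n + m)%N, s, (Num.min e d); split => //.
  - by rewrite /s => i; case: fintype.split.
  - by rewrite lt_min e0 d0.
move=> v sv; split=> i /=.
- have := sv (lshift m i); rewrite /s (unsplitK (inl i)).
  by rewrite lt_min => /andP[].
- have := sv (rshift n i); rewrite /s (unsplitK (inr i)).
  by rewrite lt_min => /andP[].
Qed.

Let seminorm_add A : seminorm_sets A ->
  exists2 B, seminorm_sets B & forall x y, B x -> B y -> A (x + y).
Proof.
move=> [n [q [e [Qq e0 ->]]]]; exists [set v | forall i, q i v < e / 2].
  by exists n, q, (e / 2); split => //; rewrite divr_gt0.
move=> x y xe ye i; apply: (le_lt_trans (QD _ _ (Qq i))).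
by rewrite [ltRHS]splitr ltrD.
Qed.

Let seminorm_convex A : seminorm_sets A -> @convex_set _ V A.
Proof.
move=> [n [q [e [Qq e0 ->]]]]; apply/convex_setE => x y t t0 t1 xe ye i /=.
have t0' := real_part_ge0 t0.
have ht : real_part `|t| = real_part t by rewrite ger0_norm.
have ht' : real_part `|1 - t| = 1 - real_part t.
  rewrite ger0_norm ?subr_ge0//.
  by apply/eqP; rewrite eq_sym subr_eq -real_partD subrK real_part1.
have t1' : 0 <= 1 - real_part t by rewrite -ht'; exact: real_part_ge0.
apply: (le_lt_trans (QD _ _ (Qq i))).
apply: (le_lt_trans (lerD (QZ _ _ (Qq i)) (QZ _ _ (Qq i)))).
rewrite ht ht'; set s := real_part t in t0' t1' *.
have [s0|s0] := eqVneq s 0.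
  by rewrite s0 mul0r add0r subr0 mul1r; exact: ye.
have -> : e = s * e + (1 - s) * e by rewrite -mulrDl subrKC mul1r.
rewrite ltr_leD//; first by rewrite ltr_pM2l ?xe// lt_neqAle eq_sym s0.
by rewrite ler_wpM2l// ltW// ye.
Qed.

Let seminorm_balanced A : seminorm_sets A -> balanced A.
Proof.
move=> [n [q [e [Qq e0 ->]]]] a x a1 xe i /=.
apply: (le_lt_trans (QZ _ _ (Qq i))); apply: le_lt_trans (xe i).
by rewrite ler_piMl ?Q0// -(@real_part1 R k) real_part_le.
Qed.

Let seminorm_absorbing A x : seminorm_sets A ->
  exists2 e : K, 0 < e & forall a, `|a| < e -> A (a *: x).
Proof.
move=> [n [q [e [Qq e0 ->]]]].
pose M := 1 + \sum_(i < n) q i x.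
have M0 : 0 < M by rewrite ltr_pwDl// sumr_ge0// => i _; exact: Q0.
exists (of_real k (e / M)); first by rewrite of_real_gt0// divr_gt0.
move=> a /real_part_lt; rewrite of_realK => ae i /=.
apply: (le_lt_trans (QZ _ _ (Qq i))).
apply: (@le_lt_trans _ _ (real_part `|a| * M)); last by rewrite -ltr_pdivlMr.
rewrite ler_wpM2l ?real_part_ge0// /M (bigD1 i)//= addrCA lerDl addr_ge0//.
by rewrite sumr_ge0// => j _; exact: Q0.
Qed.

Definition seminorm_base := LcBase seminorm_neq0 seminorm_setI seminorm_add
  seminorm_convex seminorm_balanced seminorm_absorbing.

End seminorm_base.

Section continuous_linear.
Context {K : numFieldType} {A : preTopologicalLmodType K} {E : tvsType K}.

Definition clin_pred : {pred A -> E} :=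
  [pred T : A -> E | `[< linear T /\ continuous T >]].

Record clin := Clin { clin_fun :> A -> E ; _ : clin_fun \in clin_pred }.

HB.instance Definition _ := [isSub for clin_fun].
HB.instance Definition _ := [Choice of clin by <:].

Lemma clin_linear (T : clin) : linear T.
Proof. by case: T => f /= /asboolP[]. Qed.

HB.instance Definition _ (T : clin) :=
  GRing.isLinear.Build K A E _ (clin_fun T) (clin_linear T).

Lemma clin_continuous (T : clin) : continuous T.
Proof. by case: T => f /= /asboolP[]. Qed.

Let clin_submod : GRing.submod_closed clin_pred.
Proof.
split=> [|a f g /asboolP[lf cf] /asboolP[lg cg]]; apply/asboolP; split.
- by move=> a x y; rewrite /= scaler0 addr0.
- by move=> x; exact: cvg_cst.
- move=> b x y; rewrite !fctE lf lg !scalerDr !scalerA addrACA.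
  by rewrite mulrC.
- move=> x; rewrite !fctE.
  apply: (@continuous2_cvg _ _ _ _ _ _ _ _ (fun u v : E => u + v)).
  + exact: (@add_continuous E (a *: f x, g x)).
  + apply: (@continuous2_cvg _ _ _ _ _ _ _ _ (fun (b : K^o) (v : E) => b *: v)).
    * exact: (@scale_continuous K E (a, f x)).
    * exact: cvg_cst.
    * exact: cf.
  + exact: cg.
Qed.

HB.instance Definition _ :=
  GRing.isSubmodClosed.Build K (A -> E) clin_pred clin_submod.
HB.instance Definition _ := [SubChoice_isSubLmodule of clin by <:].

End continuous_linear.
Arguments clin {K} A E.

Definition topological_isomorphism (K : numFieldType)
    (A B : preTopologicalLmodType K) (T : A -> B) :=
  linear T /\
  exists S : B -> A, [/\ cancel T S, cancel S T, continuous T & continuous S].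

Section eps_product.
Context {K : numFieldType}.

Definition dual (F : tvsType K) : Type := clin F K^o.
HB.instance Definition _ F := GRing.Lmodule.on (dual F).
HB.instance Definition _ F := Choice.on (dual F).

(* F'_c: the uniform structure on functions is the library's one of uniform
   convergence on the members of a family of sets, restricted to F'. *)
Definition dual_c (F : tvsType K) : Type := dual F.
HB.instance Definition _ F := GRing.Lmodule.copy (dual_c F) (dual F).
HB.instance Definition _ F := Topological.copy (dual_c F)
  (initial_topology (fun psi : dual F => (clin_fun psi :
    {family [set C | [/\ @convex_set K F C, balanced C & compact C]], F -> K^o}))).

Definition eps_product (E F : tvsType K) : Type := clin (dual_c F) E.
HB.instance Definition _ E F :=
  GRing.Lmodule.copy (eps_product E F) (clin (dual_c F) E).
HB.instance Definition _ E F := Topological.copy (eps_product E F)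
  (initial_topology (fun T : eps_product E F => (clin_fun T :
    {family [set W | equicontinuous W (fun psi : dual_c F => clin_fun psi)],
      dual_c F -> E}))).

End eps_product.

Section lip0.
Context {R : realType} {k : scalar_kind}.
Local Notation K := (scalar_field R k).
Context {X : metricType R} (x0 : X) (F : normedModType K).

Definition lip0_pred : {pred X -> F} := [pred f : X -> F |
  `[< f x0 = 0 /\
      exists M : R, forall x y, rnorm (f x - f y) <= M * mdist x y >]].

Record lip0 := Lip0 { lip0_fun :> X -> F ; _ : lip0_fun \in lip0_pred }.

HB.instance Definition _ := [isSub for lip0_fun].
HB.instance Definition _ := [Choice of lip0 by <:].

Let lip0_submod : GRing.submod_closed lip0_pred.
Proof.
split=> [|a f g /asboolP[f0 [M fM]] /asboolP[g0 [N gN]]]; apply/asboolP; split.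
- by [].
- exists 0 => x y; rewrite mul0r [X in rnorm X](_ : _ = 0) ?rnorm0//.
  exact: subrr.
- by rewrite !fctE f0 g0 scaler0 addr0.
- exists (real_part `|a| * M + N) => x y; rewrite !fctE opprD addrACA -scalerBr.
  rewrite (le_trans (rnormD _ _))// mulrDl lerD// rnormZ -mulrA.
  by rewrite ler_wpM2l// real_part_ge0.
Qed.

HB.instance Definition _ :=
  GRing.isSubmodClosed.Build K (X -> F) lip0_pred lip0_submod.
HB.instance Definition _ := [SubChoice_isSubLmodule of lip0 by <:].

Definition Xtilde : set (X * X) := [set p | p.1 != p.2].

Definition slope (f : lip0) (p : X * X) : R :=
  rnorm (f p.1 - f p.2) / mdist p.1 p.2.

Definition Lip (f : lip0) : R := sup [set slope f p | p in Xtilde].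

Definition lip_ball : set lip0 := [set f | Lip f <= 1].

Lemma lip0_base (f : lip0) : f x0 = 0.
Proof. by case: f => f /= /asboolP[]. Qed.

Lemma lip0_lipschitz (f : lip0) : exists2 M : R, 0 <= M &
  forall x y, rnorm (f x - f y) <= M * mdist x y.
Proof.
case: f => f /= /asboolP[_ [M fM]]; exists `|M| => // x y.
by rewrite (le_trans (fM x y))// ler_wpM2r ?mdist_ge0// ler_norm.
Qed.

Lemma lip0_add (f g : lip0) x : (f + g) x = f x + g x.
Proof. by []. Qed.

Lemma lip0_scale a (f : lip0) x : (a *: f) x = a *: f x.
Proof. by []. Qed.

Lemma slope_ge0 f p : 0 <= slope f p.
Proof. by rewrite divr_ge0// ?rnorm_ge0 ?mdist_ge0. Qed.

Lemma slope_le (f : lip0) M p : Xtilde p ->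
  (slope f p <= M) = (rnorm (f p.1 - f p.2) <= M * mdist p.1 p.2).
Proof. by move=> pX; rewrite ler_pdivrMr// mdist_gt0. Qed.

Lemma slopeD f g p : slope (f + g) p <= slope f p + slope g p.
Proof.
rewrite /slope -mulrDl ler_wpM2r ?invr_ge0 ?mdist_ge0//.
by rewrite !lip0_add opprD addrACA rnormD.
Qed.

Lemma slopeZ a f p : slope (a *: f) p = real_part `|a| * slope f p.
Proof. by rewrite /slope !lip0_scale -scalerBr rnormZ mulrA. Qed.

Lemma Lip_le f M : 0 <= M ->
  Lip f <= M <-> forall p, Xtilde p -> slope f p <= M.
Proof.
move=> M0; split=> [fM p pX|fM].
  apply: le_trans fM; apply: ub_le_sup; last by exists p.
  have [N N0 fN] := lip0_lipschitz f; exists N => _ [q qX <-].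
  by rewrite slope_le.
have [[p pX]|X0] := pselect (exists p, Xtilde p).
  apply: ge_sup; first by exists (slope f p), p.
  by move=> _ [q qX <-]; exact: fM.
suff X0' : [set slope f p | p in Xtilde] = set0 by rewrite /Lip X0' sup0.
by apply/seteqP; split => // r [p pX _]; apply: X0; exists p.
Qed.

Definition null_slope_seminorm (alpha : R^nat) (p : nat -> X * X)
  (f : lip0) : R :=
  sup [set alpha n * slope f (p n) | n in [set: nat]].

Definition null_slope_seminorms : set (lip0 -> R) :=
  [set q | exists (alpha : R^nat) (p : nat -> X * X),
    [/\ forall n, 0 < alpha n, alpha n @[n --> \oo] --> 0,
        forall n, Xtilde (p n) & q = null_slope_seminorm alpha p]].

Let null_slope_bnd (alpha : R^nat) (p : nat -> X * X) : alpha n @[n --> \oo] --> 0 ->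
  (forall n, 0 < alpha n) ->
  (forall n, Xtilde (p n)) ->
  forall f, has_sup [set alpha n * slope f (p n) | n in [set: nat]].
Proof.
move=> a0 ap pX f; split; first by exists (alpha 0%N * slope f (p 0%N)), 0%N.
have [M M0 fM] := lip0_lipschitz f.
have /cvg_seq_bounded[N [_ aN]] : cvgn alpha by apply/cvg_ex; exists 0.
exists ((N + 1) * M) => _ [n _ <-].
apply: ler_pM; [exact: ltW|exact: slope_ge0| |].
  by rewrite (le_trans (ler_norm _))// aN// ltrDl.
by rewrite slope_le.
Qed.

Let null_slope_ge0 q f : null_slope_seminorms q -> 0 <= q f.
Proof.
move=> [alpha [p [ap a0 pX ->]]].
apply: (@le_trans _ _ (alpha 0%N * slope f (p 0%N))).
  by rewrite mulr_ge0// ?slope_ge0// ltW.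
by apply: sup_upper_bound; [exact: null_slope_bnd|exists 0%N].
Qed.

Let null_slopeD q (f g : lip0) : null_slope_seminorms q -> q (f + g) <= q f + q g.
Proof.
move=> [alpha [p [ap a0 pX ->]]].
apply: ge_sup; first by exists (alpha 0%N * slope (f + g) (p 0%N)), 0%N.
move=> _ [n _ <-].
apply: (@le_trans _ _ (alpha n * slope f (p n) + alpha n * slope g (p n))).
  by rewrite -mulrDr ler_wpM2l ?slopeD// ltW.
by apply: lerD; apply: sup_upper_bound; (try exact: null_slope_bnd); exists n.
Qed.

Let null_slopeZ q a (f : lip0) : null_slope_seminorms q ->
  q (a *: f) <= real_part `|a| * q f.
Proof.
move=> [alpha [p [ap a0 pX ->]]].
apply: ge_sup; first by exists (alpha 0%N * slope (a *: f) (p 0%N)), 0%N.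
move=> _ [n _ <-]; rewrite slopeZ mulrCA ler_wpM2l// ?real_part_ge0//.
by apply: sup_upper_bound; [exact: null_slope_bnd|exists n].
Qed.

Definition lip0_gamma_tau_gamma : Type :=
  lc_space (seminorm_base null_slope_ge0 null_slopeD null_slopeZ).
HB.instance Definition _ := Tvs.copy lip0_gamma_tau_gamma
  (lc_space (seminorm_base null_slope_ge0 null_slopeD null_slopeZ)).

End lip0.
Arguments lip0 {R k X} x0 F.
Arguments lip_ball {R k X} x0 F.
Arguments lip0_pred {R k X} x0 F.
Arguments lip0_gamma_tau_gamma {R k X} x0 F.

Section mixed_topology.
Context {R : realType} (k : scalar_kind).
Local Notation K := (scalar_field R k).
Context {X : metricType R} (x0 : X).
Local Notation L := (lip0 x0 K^o).

Definition lip0_compact_open : Type := L.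
HB.instance Definition _ := GRing.Lmodule.copy lip0_compact_open L.
HB.instance Definition _ := Topological.copy lip0_compact_open
  (initial_topology (fun f : L =>
    (lip0_fun f : {family compact, X -> K^o}))).

(* Indices start at 0, so the i-th term lies in U_i and in 2^i times the unit
   ball. *)
Definition gamma_set (U : nat -> set L) : set L :=
  [set f | exists n (g : nat -> L),
    (forall i, (i <= n)%N ->
       (U i `&` [set (2 ^+ i : K) *: h | h in lip_ball x0 K^o]) (g i)) /\
    f = \sum_(i < n.+1) g i].

Definition gamma_sets : set_system L :=
  [set A | exists2 U : nat -> set L,
    (forall n, [/\ @convex_set K L (U n), balanced (U n) &
                   nbhs (0 : lip0_compact_open) (U n)]) & A = gamma_set U].

Let cballs i : set L := [set (2 ^+ i : K) *: h | h in lip_ball x0 K^o].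

Lemma lip_ballP (f : L) :
  lip_ball x0 K^o f <-> forall p, Xtilde p -> slope f p <= 1.
Proof. exact: Lip_le. Qed.

Let cballsP i (f : L) : cballs i f <-> forall p, Xtilde p -> slope f p <= 2 ^+ i.
Proof.
have r2 : real_part `|2 ^+ i : K| = 2 ^+ i.
  rewrite ger0_norm ?exprn_ge0// -[RHS](@of_realK R k); congr real_part.
  by case: k => //=; rewrite rmorphXn rmorph_nat.
have n2 : (2 ^+ i : K) != 0 by rewrite expf_neq0// pnatr_eq0.
split=> [[h /lip_ballP hB <-] p pX|fB].
  by rewrite slopeZ r2 ler_piMr ?exprn_ge0// hB.
have fE : f = (2 ^+ i : K) *: ((2 ^+ i : K)^-1 *: f).
  by rewrite scalerA divff// scale1r.
exists ((2 ^+ i : K)^-1 *: f); last by rewrite -fE.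
apply/lip_ballP => p pX; have := fB p pX.
by rewrite {1}fE slopeZ r2 ger_pMr// exprn_gt0.
Qed.

Let cballs_convex i : @convex_set K L (cballs i).
Proof.
apply/convex_setE => f g t t0 t1 /cballsP fB /cballsP gB; apply/cballsP => p pX.
rewrite (le_trans (slopeD _ _ _))// !slopeZ.
rewrite !ger0_norm ?subr_ge0//.
have -> : 2 ^+ i = real_part t * 2 ^+ i + real_part (1 - t) * 2 ^+ i :> R.
  by rewrite -mulrDl -real_partD subrKC real_part1 mul1r.
by rewrite lerD// ler_wpM2l ?fB ?gB// real_part_ge0 ?subr_ge0.
Qed.

Let cballs_balanced i : balanced (cballs i).
Proof.
move=> a f a1 /cballsP fB; apply/cballsP => p pX.
rewrite slopeZ (le_trans _ (fB p pX))// ler_piMl ?slope_ge0//.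
by rewrite -(@real_part1 R k) real_part_le.
Qed.

Let cballs_add i f g : cballs i f -> cballs i g -> cballs i.+1 (f + g).
Proof.
move=> /cballsP fB /cballsP gB; apply/cballsP => p pX.
by rewrite (le_trans (slopeD _ _ _))// exprS mulr_natl mulr2n lerD ?fB ?gB.
Qed.

Let good (U : set L) := [/\ @convex_set K L U, balanced U &
  nbhs (0 : lip0_compact_open) U].

Let good0 U : good U -> U 0.
Proof. by move=> [_ _]; exact: nbhs_singleton. Qed.

Let cball0 i : cballs i 0.
Proof.
apply/cballsP => p pX; rewrite -(@scale0r K L 0) slopeZ normr0 real_part0.
by rewrite mul0r exprn_ge0.
Qed.

Let gammaP U f : (forall n, U n 0) -> gamma_set U f <->
  exists N (g : nat -> L), (forall i, (U i `&` cballs i) (g i)) /\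
    forall n, (N <= n)%N -> f = \sum_(i < n) g i.
Proof.
move=> U0; split=> [[n [g [gU ->]]]|[N [g [gU gs]]]]; last first.
  exists N, g; split; [by move=> i _; exact: gU|exact/gs/leqnSn].
exists n.+1, (fun i => if (i <= n)%N then g i else 0); split.
  by move=> i; case: ifPn => [/gU//|_]; split => //; exact: cball0.
move=> m nm; rewrite -(big_mkord xpredT (fun i => if (i <= n)%N then g i else 0)).
rewrite (big_cat_nat (leq0n n.+1) nm)//= [X in _ = _ + X]big1_seq ?addr0; last first.
  move=> i /=; rewrite mem_index_iota => /andP[ni _].
  by rewrite leqNgt ni.
by rewrite big_mkord; apply: eq_bigr => i _; rewrite -ltnS ltn_ord.
Qed.

Let co_nbhs0 (A : set L) : nbhs (0 : lip0_compact_open) A ->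
  forall T (G : set_system T) (h : T -> L), Filter G ->
  (forall C (e : R), compact C -> 0 < e ->
    \forall z \near G, forall x : X, C x -> rnorm (h z x) < e) ->
  G (h @^-1` A).
Proof.
move=> [_ [[O oO <-] O0 OA]] T G h FG hG.
suff : ((fun z => lip0_fun (h z)) @ G) -->
    (lip0_fun (0 : L) : {family compact, X -> K^o}).
  move=> /(_ O (open_nbhs_nbhs (conj oO O0))) GO.
  by apply: (@filterS _ G FG _ _ _ GO) => z Oz; exact: OA.
apply/fam_cvgP => C cC P /uniform_nbhs[E [+ EP]].
rewrite -entourage_ballE => -[e /= e0 eE].
have e0' : 0 < real_part e by rewrite -(@real_part0 R k) real_part_lt.
apply: filterS (hG C _ cC e0') => z hz; apply: EP => x Cx; apply: eE.
rewrite -ball_normE /= sub0r normrN -(real_partK (ltW e0)).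
exact/normK_lt/hz.
Qed.

Let co_ball (C : set X) (e : R) : compact C -> 0 < e ->
  nbhs (0 : lip0_compact_open) [set f : L | forall x, C x -> rnorm (f x) < e].
Proof.
move=> cC e0.
have entE : entourage [set xy : K^o * K^o | ball xy.1 (of_real k e) xy.2].
  by rewrite -entourage_ballE; exists (of_real k e) => //=; exact: of_real_gt0.
have := @fam_nbhs X K^o compact C _ (lip0_fun (0 : L)) entE cC.
move=> /(@initial_continuous L {family compact, X -> K^o} (@lip0_fun _ _ _ _ _) 0).
move=> H; apply: (@filterS _ (nbhs (0 : lip0_compact_open)) _ _ _ _ H).
move=> f fC x Cx; have := fC x Cx; rewrite /= -ball_normE /= sub0r normrN.
by move/real_part_lt; rewrite of_realK.
Qed.

Let co_bnd (C : set X) (f : L) : compact C ->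
  exists2 M : R, 0 < M & forall x, C x -> rnorm (f x) < M.
Proof.
move=> cC.
have [M M0 fM] := lip0_lipschitz f.
have M1 : 0 < M + 1 by rewrite ltr_wpDl.
have cf : continuous (fun x => rnorm (f x) : R^o).
  move=> x; apply/cvgrPdist_lt => e e0.
  have : nbhs x (ball x (e / (M + 1))) by apply: nbhsx_ballx; rewrite divr_gt0.
  apply: filterS => y; rewrite ballEmdist /= => xy.
  have h : rnorm (f x - f y) < e.
    apply: (le_lt_trans (fM x y)); apply: (@le_lt_trans _ _ ((M + 1) * mdist x y)).
      by rewrite ler_wpM2r ?mdist_ge0// lerDl.
    by rewrite mulrC -ltr_pdivlMr.
  apply: le_lt_trans h; rewrite ler_norml lerBlDr lerBrDr addrC lerBlDr.
  apply/andP; split.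
    by rewrite -[f x - f y]opprB rnormN (le_trans _ (rnormD _ _))// subrKC.
  by rewrite (le_trans _ (rnormD _ _))// subrK.
have : compact ((fun x => rnorm (f x) : R^o) @` C).
  by apply: continuous_compact => //; exact: continuous_subspaceT.
move=> /compact_bounded[N [_ NC]].
exists (`|N| + 2) => [|x Cx]; first by rewrite ltr_wpDl.
have := NC (`|N| + 1); rewrite (le_lt_trans (ler_norm _)) ?ltrDl// => /(_ isT).
move=> /(_ (rnorm (f x))) /(_ (ex_intro2 _ _ x Cx erefl)).
rewrite /= (ger0_norm (rnorm_ge0 _)) => /le_lt_trans; apply.
by rewrite ltrD2l ltr1n.
Qed.

Let gamma_neq0 : gamma_sets !=set0.
Proof.
exists (gamma_set (fun _ => setT)), (fun _ => setT) => // _; split=> //.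
exact: filterT.
Qed.

Let gamma_setI A B : gamma_sets A -> gamma_sets B ->
  exists2 C, gamma_sets C & C `<=` A `&` B.
Proof.
move=> [U gU ->] [V gV ->]; exists (gamma_set (fun i => U i `&` V i)).
  exists (fun i => U i `&` V i) => // i.
  have [cU bU nU] := gU i; have [cV bV nV] := gV i; split.
  - apply/convex_setE => f g t t0 t1 [Uf Vf] [Ug Vg].
    split; [exact: ((convex_setE (U i)).1 cU _ _ t t0 t1 Uf Ug)|].
    exact: ((convex_setE (V i)).1 cV _ _ t t0 t1 Vf Vg).
  - by move=> a f a1 [Uf Vf]; split; [exact: bU|exact: bV].
  - exact: filterI.
move=> f [n [g [gUV ->]]].
by split; exists n, g; split => // i /gUV[[? ?] ?].
Qed.

Let gamma_add A : gamma_sets A ->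
  exists2 B, gamma_sets B & forall f g, B f -> B g -> A (f + g).
Proof.
move=> [U gU ->].
pose V i : set L := [set f : L | U i.+1 (f + f)].
have gV i : good (V i).
  have [cU bU nU] := gU i.+1; split.
  - apply/convex_setE => f g t t0 t1 Vf Vg; rewrite /V /=.
    have := (convex_setE (U i.+1)).1 cU _ _ t t0 t1 Vf Vg.
    by rewrite !scalerDr addrACA.
  - by move=> a f a1 Vf; rewrite /V /= -scalerDr; exact: bU.
  - apply: (co_nbhs0 nU (h := fun f : L => f + f)) => C e cC e0.
    have e20 : 0 < e / 2 by rewrite divr_gt0.
    apply: filterS (co_ball cC e20) => f fC x Cx.
    by rewrite lip0_add (le_lt_trans (rnormD _ _))// [ltRHS]splitr ltrD ?fC.
exists (gamma_set V); first by exists V.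
have V0 i : V i 0 by exact: good0.
have U0 i : U i 0 by exact: good0.
move=> f g /(gammaP _ V0)[N [a [aV aN]]] /(gammaP _ V0)[M [b [bV bM]]].
apply/(gammaP _ U0).
exists (maxn N M).+1, (fun i => if i is j.+1 then a j + b j else 0); split.
  move=> [|i]; first by split => //; exact: cball0.
  have [aVi aBi] := aV i; have [bVi bBi] := bV i.
  split; last exact: cballs_add.
  have [cU _ _] := gU i.+1.
  have h0 : (0 : K) <= 2^-1 by rewrite invr_ge0.
  have h1 : (2^-1 : K) <= 1 by rewrite invf_le1// ler1n.
  have := (convex_setE (U i.+1)).1 cU _ _ _ h0 h1 aVi bVi.
  have -> : (1 - 2^-1 : K) = 2^-1 by rewrite [X in X - _](splitr 1) mul1r addrK.
  have half (v : L) : (2^-1 : K) *: (v + v) = v.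
    by rewrite scalerDr -scalerDl -[X in X + X]mul1r -splitr scale1r.
  by rewrite !half.
move=> [//|n]; rewrite ltnS geq_max => /andP[Nn Mn].
by rewrite big_ord_recl add0r big_split /= -aN// -bM.
Qed.

Let gamma_convex A : gamma_sets A -> @convex_set _ L A.
Proof.
move=> [U gU ->]; have U0 i : U i 0 by exact: good0.
apply/convex_setE => f g t t0 t1 /(gammaP _ U0)[N [a [aU aN]]].
move=> /(gammaP _ U0)[M [b [bU bM]]]; apply/(gammaP _ U0).
exists (maxn N M), (fun i => t *: a i + (1 - t) *: b i); split.
  move=> i; have [aUi aBi] := aU i; have [bUi bBi] := bU i.
  have [cU _ _] := gU i.
  split; first exact: ((convex_setE (U i)).1 cU _ _ t t0 t1 aUi bUi).
  exact: ((convex_setE (cballs i)).1 (@cballs_convex i) _ _ t t0 t1 aBi bBi).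
move=> n; rewrite geq_max => /andP[Nn Mn].
by rewrite big_split /= -!scaler_sumr -aN// -bM.
Qed.

Let gamma_balanced A : gamma_sets A -> balanced A.
Proof.
move=> [U gU ->] a f a1 [n [g [gn ->]]]; exists n, (fun i => a *: g i).
split; last by rewrite scaler_sumr.
move=> i /gn[Ui Bi]; have [_ bU _] := gU i.
by split; [exact: bU|exact: cballs_balanced].
Qed.

Let gamma_absorbing A (f : L) : gamma_sets A ->
  exists2 e : K, 0 < e & forall a, `|a| < e -> A (a *: f).
Proof.
move=> [U gU ->]; have [cU bU nU] := gU 0%N.
have : nbhs (0 : K^o) [set a : K^o | U 0%N (a *: f)].
  apply: (co_nbhs0 nU (h := fun a : K^o => a *: f)) => C e cC e0.
  have [M M0 fM] := co_bnd f cC.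
  exists (of_real k (e / M)) => /=; first by rewrite of_real_gt0// divr_gt0.
  move=> a /=; rewrite sub0r normrN => /real_part_lt; rewrite of_realK => ae x Cx.
  rewrite [X in rnorm X](_ : _ = a *: f x)// rnormZ.
  apply: (@le_lt_trans _ _ (real_part `|a| * M)); last by rewrite -ltr_pdivlMr.
  by rewrite ler_wpM2l ?real_part_ge0// ltW// fM.
move=> [e /= e0 eU].
have [M M0 fM] := lip0_lipschitz f.
have M1 : 0 < M + 1 by rewrite ltr_wpDl.
have e0' : 0 < real_part e by rewrite -(@real_part0 R k) real_part_lt.
exists (of_real k (Num.min (real_part e) (M + 1)^-1)).
  by rewrite of_real_gt0// lt_min e0' invr_gt0.
move=> a /real_part_lt; rewrite of_realK lt_min => /andP[ae aM].
exists 0%N, (fun _ => a *: f); split; last by rewrite big_ord1.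
move=> i; rewrite leqn0 => /eqP ->; split.
  apply: eU; rewrite /= sub0r normrN -(real_partK (ltW e0)).
  exact: normK_lt.
apply/cballsP => p pX; rewrite slopeZ expr0.
apply: (@le_trans _ _ ((M + 1)^-1 * (M + 1))); last by rewrite mulVf// gt_eqF.
apply: ler_pM; [exact: real_part_ge0|exact: slope_ge0|exact: ltW|].
by rewrite slope_le// (le_trans (fM _ _))// ler_wpM2r ?mdist_ge0// lerDl.
Qed.

Definition gamma_base := LcBase gamma_neq0 gamma_setI gamma_add
  gamma_convex gamma_balanced gamma_absorbing.

Definition lip0_tau_gamma : Type := lc_space gamma_base.
HB.instance Definition _ := Tvs.copy lip0_tau_gamma (lc_space gamma_base).

End mixed_topology.

Section transpose.
Context {R : realType} {k : scalar_kind}.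
Local Notation K := (scalar_field R k).
Context {X : metricType R} {x0 : X} {F : normedModType K}.

Let transpose_subproof (f : lip0 x0 F) (psi : dual F) :
  (fun x => psi (f x)) \in lip0_pred x0 K^o.
Proof.
apply/asboolP; split; first by rewrite lip0_base (linear0 (clin_fun psi)).
have [M M0 fM] := lip0_lipschitz f.
have /linear_boundedP/pinfty_ex_gt0[N N0 psiN] :
  bounded_near (clin_fun psi) (nbhs (0 : F)).
  by apply: continuous_linear_bounded; exact: clin_continuous.
exists (real_part N * M) => x y; rewrite -(linearB (clin_fun psi)).
apply: (le_trans (real_part_le (psiN _))).
rewrite (real_partM _ (ltW N0)) -mulrA.
by rewrite ler_wpM2l ?fM// real_part_ge0// ltW.
Qed.

Definition transpose (f : lip0 x0 F) (psi : dual F) : lip0 x0 K^o :=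
  Lip0 (transpose_subproof f psi).

End transpose.

(* Main.v *)
Require Import Defs.
From mathcomp Require Import all_boot all_order all_algebra.
From mathcomp Require Import all_classical all_reals.
From mathcomp Require Import topology normedtype sequences derive.
From mathcomp Require Import convex complex ring lra.

Set Implicit Arguments.
Unset Strict Implicit.
Unset Printing Implicit Defensive.

Import Order.TTheory GRing.Theory Num.Theory.
Import numFieldNormedType.Exports.

Local Open Scope classical_set_scope.
Local Open Scope ring_scope.

(** Everything rests on replacing both topologies by polars of weighted slopes.
    For weights alpha n > 0 tending to 0 and pairs p n of points, let
    [slope_polar alpha p] be the set of f with alpha n * slope f (p n) <= 1 for
    all n. Up to scaling these sets are the unit balls of the seminorms of the
    domain. In the scalar case they are also a base of neighbourhoods of 0 for
    the mixed topology. That a polar is a mixed neighbourhood ([slope_polar_tau_gamma])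
    is a direct estimate. The converse ([tau_gamma_slope_polar]) is the argument
    of Banach and Dieudonne: Lipschitz balls are compact for uniform convergence
    on compact sets, so passing from one ball to a larger one while staying in a
    mixed neighbourhood costs only finitely many conditions on slopes, whose
    weights are the inverses of the radii and hence tend to 0.

    Since slope (psi \o f) p is |psi (f p.1 - f p.2)| / d(p.1, p.2), the
    transpose of f maps into a polar every functional psi that is small on the
    null sequence z n = alpha n * (f p.1 - f p.2) / d(p.1, p.2). In a Banach
    space a null sequence lies in a compact convex balanced set
    ([compact_null_hull]), so the transpose is continuous on F'_c. Uniformity
    over bounded sets of functionals makes f |-> f^t continuous, and by the
    Hahn-Banach theorem ([norming_functional]) the slope of f is the largest
    slope of psi \o f over psi of norm at most 1, which makes the map injective
    and its inverse continuous.

    For surjectivity, let T be a continuous map from F'_c. For each x the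
    functional psi |-> T psi x is bounded on the functionals that are small on
    some compact convex balanced set, so it is the evaluation at a point f x
    of F ([representation]). The continuity of T for a single well chosen
    slope polar then shows that f is Lipschitz. *)

(** * Scalars *)

Section scalars.
Context {R : realType} {k : scalar_kind}.
Local Notation K := (scalar_field R k).
Implicit Types (a b c : K) (r s : R).

Lemma exp2_unbounded r : exists n, r <= 2 ^+ n.
Proof.
exists (Num.truncn r).+1; rewrite (le_trans (ltW (Num.Theory.truncnS_gt _)))//.
by rewrite -natrX ler_nat ltnW// ltn_expl.
Qed.

Lemma of_realD r s : of_real k (r + s) = of_real k r + of_real k s.
Proof. by case: k => //=; rewrite rmorphD. Qed.

Lemma of_realM r s : of_real k (r * s) = of_real k r * of_real k s.
Proof. by case: k => //=; rewrite rmorphM. Qed.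

Lemma of_real0 : of_real k (0 : R) = 0. Proof. by case: k. Qed.

Lemma of_real1 : of_real k (1 : R) = 1. Proof. by case: k. Qed.

Lemma of_realN r : of_real k (- r) = - of_real k r.
Proof. by case: k => //=; rewrite rmorphN. Qed.

Lemma of_real_le r s : r <= s -> of_real k r <= of_real k s.
Proof. by rewrite le_eqVlt => /predU1P[->//|/of_real_lt-/(_ k)/ltW]. Qed.

Lemma norm_of_real r : `|of_real k r| = of_real k `|r|.
Proof.
case: (lerP 0 r) => r0.
  by rewrite !ger0_norm// -of_real0 of_real_le.
by rewrite !ltr0_norm ?of_realN// -of_real0 of_real_lt.
Qed.

Lemma real_partN a : real_part (- a) = - real_part a.
Proof. by move: a; case: k => //= -[]. Qed.

Lemma real_part_of_realM r a : real_part (of_real k r * a) = r * real_part a.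
Proof. by move: a; case: k => //= -[? ?] /=; rewrite mul0r subr0. Qed.

Lemma real_part_le_norm a : real_part a <= real_part `|a|.
Proof.
move: a; case: k => [a|a]; first exact: ler_norm.
apply: (le_trans (ler_norm _)).
exact: (@real_part_le R ComplexScalars _ _ (normc_ge_Re a)).
Qed.

(** Transfers bounds on the real parts of the members of a balanced set to
    bounds on their moduli. *)
Lemma rotate_norm a :
  exists2 c, `|c| <= 1 & c * a = of_real k (real_part `|a|).
Proof.
rewrite real_partK//; have [->|a0] := eqVneq a 0.
  by exists 0; rewrite ?mul0r normr0// ler01.
exists (`|a| / a); last by rewrite divfK.
by rewrite normrM normfV normr_id divff// normr_eq0.
Qed.

Lemma real_part_eq a b :
  (forall c, real_part (c * a) = real_part (c * b)) -> a = b.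
Proof.
move=> ab; have [c _ cab] := rotate_norm (a - b).
have : real_part (c * (a - b)) = 0.
  by rewrite mulrBr real_partD real_partN ab subrr.
rewrite cab of_realK => n0; apply/eqP; rewrite -subr_eq0 -normr_eq0.
by rewrite -(real_partK (normr_ge0 _)) n0 of_real0.
Qed.

End scalars.

Section rnorm.
Context {R : realType} {k : scalar_kind}.
Local Notation K := (scalar_field R k).
Context {V : normedModType K}.
Implicit Types (u v : V) (e : R).

Lemma normE v : `|v| = of_real k (rnorm v).
Proof. by rewrite real_partK. Qed.

Lemma rnorm_of_realZ r v : rnorm (of_real k r *: v) = `|r| * rnorm v.
Proof. by rewrite rnormZ norm_of_real of_realK. Qed.

Lemma rnorm_of_real r : rnorm (of_real k r : K^o) = `|r|.
Proof. exact: etrans (congr1 real_part (norm_of_real r)) (of_realK _). Qed.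

Lemma rnormM (a b : K^o) : rnorm (a * b : K^o) = rnorm a * rnorm b.
Proof. exact: (rnormZ a b). Qed.

Lemma rnorm_eq0 v : rnorm v = 0 -> v = 0.
Proof. by move=> v0; apply/eqP; rewrite -normr_eq0 normE v0 of_real0. Qed.

Lemma rnormB u v : rnorm (u - v) = rnorm (v - u).
Proof. by rewrite -rnormN opprB. Qed.

Lemma rnorm_triangle u v w : rnorm (u - w) <= rnorm (u - v) + rnorm (v - w).
Proof. by rewrite (le_trans _ (rnormD _ _))// addrA subrK. Qed.

Lemma balln_rnorm u v e : ball u (of_real k e) v <-> rnorm (u - v) < e.
Proof.
rewrite -ball_normE /=; split; last by rewrite normE; exact: of_real_lt.
by move=> /real_part_lt; rewrite of_realK.
Qed.

Lemma nbhs_rnorm v (A : set V) :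
  nbhs v A <-> exists2 e, 0 < e & forall u, rnorm (u - v) < e -> A u.
Proof.
split=> [/nbhs_ballP[d /= d0 dA]|[e e0 eA]].
  exists (real_part d) => [|u uv]; first by rewrite -(@real_part0 R k) real_part_lt.
  by apply: dA; rewrite -(real_partK (ltW d0)); apply/balln_rnorm; rewrite rnormB.
apply/nbhs_ballP; exists (of_real k e) => /=; first exact: of_real_gt0.
by move=> u /balln_rnorm; rewrite rnormB; exact: eA.
Qed.

Lemma entourage_rnorm (E : set (V * V)) :
  entourage E <-> exists2 e, 0 < e & forall u v, rnorm (u - v) < e -> E (u, v).
Proof.
rewrite -entourage_ballE; split=> [[d /= d0 dE]|[e e0 eE]].
  exists (real_part d) => [|u v uv]; first by rewrite -(@real_part0 R k) real_part_lt.
  by apply: dE; rewrite -(real_partK (ltW d0)); exact/balln_rnorm.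
exists (of_real k e) => /=; first exact: of_real_gt0.
by move=> [u v] /balln_rnorm /eE.
Qed.

End rnorm.

(** * The Hahn-Banach theorem *)

Section hahn_banach.
Context {R : realType} {k : scalar_kind}.
Local Notation K := (scalar_field R k).
Local Notation "r *r x" := (of_real k r *: x) (at level 40).
Context {V : normedModType K}.
Implicit Types (q : V -> R) (x y v : V).

Definition sublinear q := (forall x y, q (x + y) <= q x + q y) /\
  (forall t x, 0 <= t -> q (t *r x) <= t * q x).

Lemma sublinear0 q : sublinear q -> q 0 = 0.
Proof.
move=> [qD qZ]; apply/eqP; rewrite eq_le.
have := qZ 0 0 (lexx _); rewrite mul0r scaler0 => -> /=.
by have := qD 0 0; rewrite addr0; lra.
Qed.

Lemma sublinearN q x : sublinear q -> - q (- x) <= q x.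
Proof.
move=> sq; have := sq.1 x (- x); rewrite subrr sublinear0//; lra.
Qed.

Lemma sublinearZ q t x : sublinear q -> 0 <= t -> q (t *r x) = t * q x.
Proof.
move=> sq t0; have [->|tn0] := eqVneq t 0.
  by rewrite of_real0 scale0r sublinear0// mul0r.
apply/eqP; rewrite eq_le sq.2//=.
have := sq.2 t^-1 (t *r x); rewrite invr_ge0 => /(_ t0).
rewrite scalerA -of_realM mulVf// of_real1 scale1r => h.
by rewrite -ler_pdivlMl// lt_neqAle eq_sym tn0.
Qed.

Lemma sublinear_rnorm : sublinear (@rnorm R k V).
Proof.
split=> [|t x t0]; first exact: rnormD.
by rewrite rnorm_of_realZ ger0_norm.
Qed.

(** The largest sublinear functional below q whose value at - v is at most
    - q v. *)
Definition tilt q v x := inf [set q (x + t *r v) - t * q v | t in [set t | 0 <= t]].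

Lemma tilt_le q v x t : sublinear q -> 0 <= t ->
  tilt q v x <= q (x + t *r v) - t * q v.
Proof.
move=> sq t0; apply: ge_inf; last by exists t.
exists (- q (- x)) => _ [s /= s0 <-].
by have := sq.1 (x + s *r v) (- x); rewrite addrC addKr (sublinearZ v sq s0); lra.
Qed.

Lemma le_tilt q v x M :
  (forall t, 0 <= t -> M <= q (x + t *r v) - t * q v) -> M <= tilt q v x.
Proof.
move=> h; apply: lb_le_inf; first by exists (q (x + 0 *r v) - 0 * q v), 0 => /=.
by move=> _ [t /= t0 <-]; exact: h.
Qed.

Lemma tilt_le_id q v x : sublinear q -> tilt q v x <= q x.
Proof.
move=> sq; have := tilt_le v x sq (lexx 0).
by rewrite of_real0 scale0r addr0 mul0r subr0.
Qed.

Lemma tiltN q v : sublinear q -> tilt q v (- v) <= - q v.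
Proof.
move=> sq; have := tilt_le v (- v) sq ler01.
by rewrite of_real1 scale1r addNr sublinear0// mul1r sub0r.
Qed.

Lemma sublinear_tilt q v : sublinear q -> sublinear (tilt q v).
Proof.
move=> sq; split=> [x y|c x c0].
  rewrite -lerBlDr; apply: le_tilt => t t0; rewrite lerBlDr -lerBlDl.
  apply: le_tilt => s s0; rewrite lerBlDl.
  apply: (le_trans (tilt_le v (x + y) sq (addr_ge0 t0 s0))).
  rewrite of_realD scalerDl addrACA mulrDl.
  by have := sq.1 (x + t *r v) (y + s *r v); lra.
have [->|cn0] := eqVneq c 0.
  by rewrite of_real0 scale0r mul0r (le_trans (tilt_le_id _ _ sq))// sublinear0.
have c_gt0 : 0 < c by rewrite lt_neqAle eq_sym cn0.
rewrite -ler_pdivrMl//; apply: le_tilt => t t0; rewrite ler_pdivrMl//.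
apply: (le_trans (tilt_le v _ sq (mulr_ge0 c0 t0))).
by rewrite of_realM -scalerA -scalerDr (sublinearZ _ sq c0) mulrBr mulrA.
Qed.

(** Since A is a chain, two members can be compared when proving that the
    infimum is subadditive. The common bound p makes the infimum finite:
    q x >= - q (- x) >= - p (- x). *)
Lemma sublinear_chain (A : set (V -> R)) p : A !=set0 ->
  (forall q, A q -> sublinear q /\ forall x, q x <= p x) ->
  (forall q r, A q -> A r -> (forall x, q x <= r x) \/ (forall x, r x <= q x)) ->
  exists2 m, sublinear m & forall q, A q -> forall x, m x <= q x.
Proof.
move=> [q0 Aq0] sA tA.
pose m x := inf [set q x | q in A].
have mle q x : A q -> m x <= q x.
  move=> Aq; apply: ge_inf; last by exists q.
  exists (- p (- x)) => _ [r /= /sA[sr rp] <-].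
  by have := sublinearN x sr; have := rp (- x); lra.
have glb x M : (forall q, A q -> M <= q x) -> M <= m x.
  move=> h; apply: lb_le_inf; first by exists (q0 x), q0.
  by move=> _ [q /= Aq <-]; exact: h.
exists m => [|q Aq x]; last exact: mle.
split=> [x y|t x t0].
  rewrite -lerBlDr; apply: (glb) => q Aq; rewrite lerBlDr -lerBlDl.
  apply: (glb) => r Ar; rewrite lerBlDl.
  case: (tA _ _ Aq Ar) => qr.
    rewrite (le_trans (mle q _ Aq))// (le_trans ((sA _ Aq).1.1 _ _))//.
    by rewrite lerD2l.
  rewrite (le_trans (mle r _ Ar))// (le_trans ((sA _ Ar).1.1 _ _))//.
  by rewrite lerD2r.
have [->|tn0] := eqVneq t 0.
  rewrite of_real0 scale0r mul0r (le_trans (mle q0 _ Aq0))//.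
  by rewrite sublinear0//; exact: (sA _ Aq0).1.
have t_gt0 : 0 < t by rewrite lt_neqAle eq_sym tn0.
rewrite -ler_pdivrMl//; apply: (glb) => q Aq; rewrite ler_pdivrMl//.
by rewrite (le_trans (mle q _ Aq))// (sA _ Aq).1.2.
Qed.

(** Zorn's lemma applied to whole sublinear functionals: a minimal one equals
    each of its tilts, which forces it to be odd, hence linear. *)
Lemma sublinear_minorant p : sublinear p ->
  exists u, [/\ sublinear u, forall x, u x <= p x & forall x, u (- x) = - u x].
Proof.
move=> sp; pose T := {q : V -> R | sublinear q /\ forall x, q x <= p x}.
pose le (q r : T) := `[< forall x, sval r x <= sval q x >].
have [//|||A totA|[u [su up]] umin] := @Zorn T le.
- by move=> q; apply/asboolP.
- move=> q r s /asboolP qr /asboolP rs; apply/asboolP => x.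
  exact: le_trans (rs x) (qr x).
- move=> [q qP] [r rP] /asboolP /= qr /asboolP /= rq; apply: eq_exist => /=.
  by apply/funext => x; apply/eqP; rewrite eq_le rq qr.
- have [[q0 Aq0]|A0] := pselect (A !=set0); last first.
    have pT : sublinear p /\ forall x, p x <= p x by [].
    by exists (exist _ p pT) => s As; exfalso; apply: A0; exists s.
  have [|||m sm mA] := @sublinear_chain [set sval q | q in A] p.
  + by exists (sval q0), q0.
  + by move=> _ [q _ <-]; exact: (svalP q).
  + move=> _ _ [q Aq <-] [r Ar <-].
    by case: (totA _ _ Aq Ar) => /asboolP; [right|left].
  have mp x : m x <= p x.
    by rewrite (le_trans (mA (sval q0) _ x))//; [exists q0|exact: (svalP q0).2].
  exists (exist _ m (conj sm mp)) => s As; apply/asboolP => x /=.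
  by apply: mA; exists s.
exists u; split => // x; apply/eqP; rewrite eq_le lerNl.
have := sublinearN (- x) su; rewrite opprK lerNl => -> /=.
have tp y : tilt u x y <= p y by rewrite (le_trans (tilt_le_id _ _ su)).
have := umin (exist _ (tilt u x) (conj (sublinear_tilt x su) tp)).
have tu : le (exist _ u (conj su up)) (exist _ (tilt u x) (conj (sublinear_tilt x su) tp)).
  by apply/asboolP => y; exact: tilt_le_id.
move=> /(_ tu) /(congr1 sval) /= tE.
by rewrite andbT; have := tiltN x su; rewrite tE.
Qed.

Lemma odd_sublinear_additive q : sublinear q -> (forall x, q (- x) = - q x) ->
  forall x y, q (x + y) = q x + q y.
Proof.
move=> sq qN x y; apply/eqP; rewrite eq_le sq.1/=.
by have := sq.1 (x + y) (- y); rewrite addrK qN; lra.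
Qed.

Lemma odd_sublinear_homogeneous q : sublinear q -> (forall x, q (- x) = - q x) ->
  forall t x, q (t *r x) = t * q x.
Proof.
move=> sq qN t x; have [t0|t0] := leP 0 t; first exact: sublinearZ.
by rewrite -[t]opprK of_realN scaleNr qN sublinearZ ?mulNr// oppr_ge0 ltW.
Qed.

(** Tilting the norm in the direction v before minimising gives
    u (- v) <= - rnorm v, so that u attains the norm at v. *)
Lemma real_functional (v : V) : exists u : V -> R,
  [/\ forall x y, u (x + y) = u x + u y, forall t x, u (t *r x) = t * u x,
      forall x, u x <= rnorm x & u v = rnorm v].
Proof.
have sn := sublinear_rnorm.
have [u [su ut uN]] := sublinear_minorant (sublinear_tilt v sn).
have un x : u x <= rnorm x := le_trans (ut x) (tilt_le_id v x sn).
exists u; split => //.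
- exact: odd_sublinear_additive.
- exact: odd_sublinear_homogeneous.
- apply/eqP; rewrite eq_le un/=.
  by have := le_trans (ut (- v)) (tiltN v sn); rewrite uN lerN2.
Qed.

End hahn_banach.

Section duality.
Context {R : realType} {k : scalar_kind}.
Local Notation K := (scalar_field R k).
Context {V : normedModType K}.

Lemma dual0 (psi : dual V) : psi 0 = 0.
Proof. exact: (linear0 (clin_fun psi)). Qed.

Lemma dualB (psi : dual V) x y : psi (x - y) = psi x - psi y.
Proof. exact: (linearB (clin_fun psi)). Qed.

Lemma dualZ (psi : dual V) a x : psi (a *: x) = a * psi x.
Proof. by have := clin_linear psi a x 0; rewrite dual0 !addr0. Qed.

(** Over the complex numbers the functional is recovered from its real part
    u by x |-> u x - i u (i x). *)
Lemma functional_of_real_part (u : V -> R) :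
  (forall x y, u (x + y) = u x + u y) ->
  (forall t x, u (of_real k t *: x) = t * u x) ->
  exists2 g : V -> K^o, linear g & forall x, real_part (g x) = u x.
Proof.
move: V u; case: k => /= W u uD uZ.
  by exists u => // a x y; rewrite uD uZ.
pose i : R[i] := 'i%C.
exists (fun x => (u x +i* - u (i *: x))%C) => //.
have uN x : u (- x) = - u x.
  by have := uZ (-1) x; rewrite rmorphN rmorph1 scaleN1r mulN1r.
move=> [a b] x y.
have dec z : ((a +i* b)%C : R[i]) *: z = a%:C%C *: z + b%:C%C *: (i *: z).
  rewrite scalerA -scalerDl; congr (_ *: _).
  by apply/eqP; rewrite eq_complex /=; apply/andP; split; apply/eqP; ring.
rewrite [LHS](_ : _ = ((u ((a +i* b)%C *: x) + u y) +i*
    - (u ((a +i* b)%C *: (i *: x)) + u (i *: y)))%C); last first.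
  by rewrite uD scalerDr uD !scalerA (mulrC i).
rewrite !dec !uD !uZ.
have -> : i *: (i *: x) = - x.
  by rewrite scalerA -expr2 sqr_i scaleN1r.
rewrite uN; apply/eqP; rewrite eq_complex /=.
by apply/andP; split; apply/eqP; rewrite /=; ring.
Qed.

Lemma clin_of_bounded (g : V -> K^o) (M : R) : linear g ->
  (forall x, rnorm (g x) <= M * rnorm x) -> exists psi : dual V, psi = g :> (V -> K^o).
Proof.
move=> lg gM; have /asboolP : linear g /\ continuous g.
  split=> // x; apply/(@cvgrPdist_lt _ K^o) => e e0.
  apply/nbhs_rnorm; exists (real_part e / (`|M| + 1)).
    rewrite divr_gt0// ?ltr_wpDl// -(@real_part0 R k) real_part_lt//.
  move=> y yx; rewrite -(real_partK (ltW e0)); apply: normK_lt.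
  have -> : g x - g y = g (x - y).
    by rewrite -[g y]scale1r -scaleNr addrC -lg scaleN1r addrC.
  apply: (le_lt_trans (gM _)); rewrite rnormB.
  move: yx; rewrite ltr_pdivlMr ?ltr_wpDl//; apply: le_lt_trans.
  by rewrite mulrC ler_wpM2l ?rnorm_ge0// (le_trans (ler_norm _))// lerDl.
by move=> gP; exists (Clin gP).
Qed.

Lemma dual_bounded (psi : dual V) :
  exists2 N : R, 0 < N & forall x, rnorm (psi x : K^o) <= N * rnorm x.
Proof.
have /linear_boundedP/pinfty_ex_gt0[N N0 psiN] :
  bounded_near (clin_fun psi) (nbhs (0 : V)).
  by apply: continuous_linear_bounded; exact: clin_continuous.
exists (real_part N) => [|x]; first by rewrite -(@real_part0 R k) real_part_lt.
by apply: (le_trans (real_part_le (psiN _))); rewrite (real_partM _ (ltW N0)).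
Qed.

Lemma norming_functional (v : V) : exists psi : dual V,
  (forall x, rnorm (psi x : K^o) <= rnorm x) /\ real_part (psi v) = rnorm v.
Proof.
have [u [uD uZ un uv]] := real_functional v.
have [g lg gu] := functional_of_real_part uD uZ.
have g0 : g 0 = 0.
  by have := lg (-1) 0 0; rewrite scaleN1r oppr0 addr0 scaleN1r addNr.
have gZ a x : g (a *: x) = a * g x by have := lg a x 0; rewrite g0 !addr0.
have gn x : rnorm (g x) <= rnorm x.
  (* the bound on u only concerns real parts, so rotate g x first *)
  have [c c1 cg] := rotate_norm (g x).
  have -> : rnorm (g x) = u (c *: x) by rewrite -gu gZ cg of_realK.
  rewrite (le_trans (un _))// rnormZ ler_piMl ?rnorm_ge0//.
  by rewrite -(@real_part1 R k) real_part_le.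
have [|psi psiE] := @clin_of_bounded g 1 lg.
  by move=> x; rewrite mul1r.
by exists psi; rewrite psiE gu.
Qed.

Lemma dual_separates (v : V) : (forall psi : dual V, psi v = 0) -> v = 0.
Proof.
move=> v0; have [psi [_ psiv]] := norming_functional v.
by apply: rnorm_eq0; rewrite -psiv v0 real_part0.
Qed.

End duality.

(** * Compact sets in normed spaces over the scalars *)

Section normed_topology.
Context {R : realType} {k : scalar_kind}.
Local Notation K := (scalar_field R k).

Lemma closed_rnorm (V : normedModType K) (A : set V) :
  (forall x, (forall e, 0 < e -> exists2 a, A a & rnorm (x - a) < e) -> A x) ->
  closed A.
Proof.
move=> h x clx; apply: h => e e0.
have [|a [Aa ax]] := clx [set y | rnorm (x - y) < e]; last by exists a.
by apply/nbhs_rnorm; exists e => // u; rewrite rnormB.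
Qed.

Lemma closed_disc (r : R) : closed [set a : K^o | rnorm a <= r].
Proof.
apply: closed_rnorm => x h /=; apply/ler_addgt0Pr => e e0.
have [a /= ar xa] := h e e0.
by have := rnormD (x - a) a; rewrite subrK; lra.
Qed.

Lemma compact_disc (r : R) : compact [set a : K^o | rnorm a <= r].
Proof.
suff [D cD rD] : exists2 D : set K^o, compact D &
    [set a : K^o | rnorm a <= r] `<=` D.
  exact: (subclosed_compact (@closed_disc r) cD rD).
move: r; case: k => r.
  exists `[- r, r]%classic; first exact: segment_compact.
  by move=> a /=; rewrite /rnorm /= in_itv /= -ler_norml.
pose I : (scalar_field R ComplexScalars)^o := ('i%C : R[i]).
have nI : rnorm I = 1.
  apply/eqP; rewrite -(@eqrXn2 _ 2) ?rnorm_ge0// expr1n expr2 -rnormM.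
  have -> : I * I = - 1 by exact: sqr_i.
  by rewrite rnormN /rnorm normr1.
pose f (p : R^o * R^o) : (scalar_field R ComplexScalars)^o := (p.1 +i* p.2)%C.
exists (f @` (`[- r, r]%classic `*` `[- r, r]%classic)).
  apply: continuous_compact; last first.
    by apply: compact_setX; exact: segment_compact.
  apply: continuous_subspaceT => -[a b] A /nbhs_rnorm[e e0 eA].
  have e2 : 0 < e / 2 by rewrite divr_gt0.
  exists (ball a (e / 2), ball b (e / 2)).
    by split; exact: nbhsx_ballx.
  move=> [c d] /= []; rewrite -!ball_normE /= => ac bd; apply: eA.
  have -> : f (c, d) - f (a, b) =
      of_real ComplexScalars (c - a) + I * of_real ComplexScalars (d - b).
    by apply/eqP; rewrite eq_complex /=; apply/andP; split; apply/eqP; ring.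
  apply: (le_lt_trans (rnormD _ _)).
  rewrite rnormM nI mul1r !rnorm_of_real.
  by rewrite [e]splitr ltrD// distrC.
move=> [a b] ab.
have reE (x y : R) : `|x| <= rnorm ((x +i* y)%C : (scalar_field R ComplexScalars)^o).
  exact: (@real_part_le R ComplexScalars _ _ (normc_ge_Re (x +i* y)%C)).
have ar : `|a| <= r := le_trans (reE a b) ab.
have br : `|b| <= r.
  rewrite -normrN (le_trans (reE (- b) a))// (le_trans _ ab)//.
  rewrite -[leRHS]mul1r -nI -rnormM (_ : I * _ = (- b +i* a)%C)//.
  by apply/eqP; rewrite eq_complex /=; apply/andP; split; apply/eqP; ring.
by exists (a, b) => //; split; rewrite /= in_itv /= -ler_norml.
Qed.

End normed_topology.

Section approximation.
Context {R : realType} {k : scalar_kind}.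
Local Notation K := (scalar_field R k).
Context {V : completeNormedModType K}.

(** An ultrafilter on C is Cauchy: its image under a choice d of nearby points
    of a compact set clusters at some y, and the ultrafilter then contains a
    small ball around y. *)
Lemma compact_approx (C : set V) : closed C ->
  (forall e : R, 0 < e -> exists2 D : set V, compact D &
    forall x, C x -> exists2 d, D d & rnorm (x - d) < e) -> compact C.
Proof.
move=> cC hC; rewrite compact_ultra => F UF FC.
have cF : cauchy F.
  apply/cauchy_exP => eps /= eps0.
  pose e := real_part eps / 2.
  have e0 : 0 < e by rewrite divr_gt0// -(@real_part0 R k) real_part_lt.
  have [D cD hD] := hC e e0.
  have /choice[d dP] : forall x, exists d, C x -> D d /\ rnorm (x - d) < e.
    move=> x; have [Cx|nCx] := pselect (C x); last by exists 0.
    by have [d Dd xd] := hD x Cx; exists d.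
  have dF : (d @ F) D by apply: (@filterS _ F _ C) => // x Cx; exact: (dP x Cx).1.
  have [y [Dy yF]] := cD _ _ dF.
  exists y; rewrite -(real_partK (ltW eps0)).
  have [//|Fn] := in_ultra_setVsetC (ball y (of_real k (real_part eps))) UF.
  have [||z [[x [Cx nx] <-] yz]] := yF (d @` (C `&` ~` ball y (of_real k (real_part eps))))
    [set z | rnorm (y - z) < e].
  - by apply: (@filterS _ F _ _ _ _ (filterI FC Fn)) => x Cx; exists x.
  - by apply/nbhs_rnorm; exists e => // u; rewrite rnormB.
  exfalso; apply: nx; apply/balln_rnorm; have [_ xd] := dP x Cx.
  rewrite (le_lt_trans (rnorm_triangle y (d x) x))// [ltRHS]splitr ltrD//.
  by rewrite rnormB.
have /cvg_ex[l Fl] : cvg F by exact: cauchy_cvg.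
exists l; split => //; apply: cC => B /Fl FB.
exact: (@filter_ex _ F _ _ (filterI FC FB)).
Qed.

Variable z : nat -> V.

Definition disc_sums N : set V :=
  [set \sum_(i < N) a i *: z i | a in [set a : nat -> K | forall i, `|a i| <= 1]].

Lemma compact_disc_sums N : compact (disc_sums N).
Proof.
elim: N => [|N IH].
  rewrite (_ : disc_sums 0 = [set 0]); first exact: compact_set1.
  apply/seteqP; split=> [_ [a _ <-]|_ ->]; first by rewrite big_ord0.
  by exists (fun=> 0) => [i /=|]; rewrite ?normr0 ?ler01 ?big_ord0.
rewrite (_ : disc_sums N.+1 = (fun p : V * K^o => p.1 + p.2 *: z N) @`
    (disc_sums N `*` [set a : K^o | rnorm a <= 1])).
  apply: continuous_compact; last by apply: compact_setX => //; exact: compact_disc.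
  apply: continuous_subspaceT => -[u a]; apply: cvgD; first exact: cvg_fst.
  by apply: cvgZr_tmp; exact: cvg_snd.
apply/seteqP; split=> [_ [a a1 <-]|_ [[u b] [[a a1 <-] b1] <-]].
  rewrite big_ord_recr; exists (\sum_(i < N) a i *: z i, a N) => //.
  split; first by exists a.
  by rewrite /= -(@real_part1 R k); apply/real_part_le/a1.
exists (fun i => if (i < N)%N then a i else b).
  move=> i /=; case: ifP => // _.
  by rewrite -(real_partK (normr_ge0 _)) -(@of_real1 R k) of_real_le.
rewrite big_ord_recr /= ltnn; congr (_ + _).
by apply: eq_bigr => i _; rewrite ltn_ord.
Qed.

Lemma disc_sums_convex N u v (t : K) : 0 <= t -> t <= 1 ->
  disc_sums N u -> disc_sums N v -> disc_sums N (t *: u + (1 - t) *: v).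
Proof.
move=> t0 t1 [a a1 <-] [b b1 <-]; exists (fun i => t * a i + (1 - t) * b i).
  move=> i /=; rewrite (le_trans (ler_normD _ _))// !normrM.
  rewrite (ger0_norm t0) (@ger0_norm _ (1 - t)) ?subr_ge0//.
  rewrite -[leRHS](subrKC t) lerD//; first by rewrite ler_piMr// a1.
  by rewrite ler_piMr ?subr_ge0// b1.
rewrite !scaler_sumr -big_split /=; apply: eq_bigr => i _.
by rewrite scalerDl !scalerA.
Qed.

Lemma disc_sums_balanced N : balanced (disc_sums N).
Proof.
move=> c _ c1 [a a1 <-]; exists (fun i => c * a i).
  by move=> i /=; rewrite normrM mulr_ile1// a1.
by rewrite scaler_sumr; apply: eq_bigr => i _; rewrite scalerA.
Qed.

Lemma disc_sums0 N : disc_sums N 0.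
Proof.
exists (fun=> 0) => [i /=|]; first by rewrite normr0 ler01.
by rewrite big1// => i _; rewrite scale0r.
Qed.

Lemma disc_sums_mem N n : (n < N)%N -> disc_sums N (z n).
Proof.
move=> nN; exists (fun i => (i == n)%:R).
  by move=> i /=; case: (_ == _); rewrite ?normr1 ?normr0 ?ler01.
rewrite (bigD1 (Ordinal nN))//= eqxx scale1r big1 ?addr0// => i ni.
by rewrite (_ : _ == _ = false) ?scale0r//; exact: negbTE.
Qed.

(** Contains the closed absolutely convex hull of the sequence, and is
    easier to handle: it stays within any bound of the tail of z from the
    compact set [disc_sums N], which makes it compact when z tends to 0. The
    second radius delta makes the set closed. *)
Definition null_hull : set V := [set x | forall N (eta delta : R),
  (forall n, (N <= n)%N -> rnorm (z n) <= eta) -> eta < delta ->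
  exists2 d, disc_sums N d & rnorm (x - d) < delta].

Lemma null_hull_mem n : null_hull (z n).
Proof.
move=> N eta delta zN ed; have [nN|Nn] := ltnP n N.
  exists (z n); first exact: disc_sums_mem.
  rewrite subrr rnorm0; apply: le_lt_trans ed.
  by apply: (le_trans _ (zN N _)); rewrite ?rnorm_ge0.
exists 0; first exact: disc_sums0.
by rewrite subr0 (le_lt_trans (zN _ Nn)).
Qed.

Lemma null_hull_convex : @convex_set K V null_hull.
Proof.
apply/convex_setE => x y t t0 t1 Cx Cy N eta delta zN ed.
have [ed1 ed2] : eta < (eta + delta) / 2 /\ (eta + delta) / 2 < delta by lra.
have [d Dd xd] := Cx N eta _ zN ed1; have [e De ye] := Cy N eta _ zN ed1.
exists (t *: d + (1 - t) *: e); first exact: disc_sums_convex.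
have -> : t *: x + (1 - t) *: y - (t *: d + (1 - t) *: e) =
    t *: (x - d) + (1 - t) *: (y - e).
  by rewrite opprD addrACA -!scalerBr.
apply: le_lt_trans ed2; rewrite (le_trans (rnormD _ _))// !rnormZ.
rewrite (ger0_norm t0) (@ger0_norm _ (1 - t)) ?subr_ge0//.
have -> : real_part (1 - t) = 1 - real_part t.
  by rewrite real_partD real_partN real_part1.
have h0 := real_part_ge0 t0; have h1 : real_part t <= 1.
  by rewrite -(@real_part1 R k) real_part_le.
by nra.
Qed.

Lemma null_hull_balanced : balanced null_hull.
Proof.
move=> a x a1 Cx N eta delta zN ed; have [d Dd xd] := Cx N eta delta zN ed.
exists (a *: d); first exact: disc_sums_balanced.
rewrite -scalerBr rnormZ; apply: le_lt_trans xd.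
by rewrite ler_piMl ?rnorm_ge0// -(@real_part1 R k) real_part_le.
Qed.

Lemma closed_null_hull : closed null_hull.
Proof.
apply: closed_rnorm => x h N eta delta zN ed.
have [ed1 ed2] : eta < (eta + delta) / 2 /\ 0 < (delta - eta) / 2 by lra.
have [y Cy xy] := h _ ed2; have [d Dd yd] := Cy N eta _ zN ed1.
exists d => //; rewrite (le_lt_trans (rnorm_triangle x y d))//.
by lra.
Qed.

Lemma compact_null_hull :
  (forall e : R, 0 < e -> \forall n \near \oo, rnorm (z n) <= e) ->
  compact null_hull.
Proof.
move=> z0; apply: compact_approx; first exact: closed_null_hull.
move=> e e0; have [|N _ zN] := z0 (e / 2); first exact: divr_gt0.
exists (disc_sums N); first exact: compact_disc_sums.
by move=> x Cx; apply: (Cx N (e / 2)); [exact: zN|lra].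
Qed.

End approximation.

(** * Neighbourhoods in topologies of uniform convergence *)

Section initial_family.
Context {S U : choiceType} {V : uniformType} (fam : set U -> Prop).
Variable j : S -> {family fam, U -> V}.

(** Directedness of the family is what makes a single member and a single
    entourage enough for a neighbourhood. *)
Lemma nbhs_initial_family (x : initial_topology j) (A : set S) :
  (exists C, fam C) ->
  (forall C D, fam C -> fam D -> exists2 B, fam B & C `|` D `<=` B) ->
  nbhs x A <-> exists C E, [/\ fam C, entourage E &
    forall y, (forall u, C u -> E (j x u, j y u)) -> A y].
Proof.
move=> [C0 fC0] famU; split=> [[_ [[O oO <-] Ox OA]]|[C [E [fC eE CEA]]]]; last first.
  have : nbhs (j x) [set g | forall u, C u -> E (j x u, g u)] by exact: fam_nbhs.
  move=> /(@initial_continuous S _ j x) h.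
  by apply: (@filterS _ (nbhs x) _ _ _ _ h) => y; exact: CEA.
pose G : set_system S := [set B | exists C E, [/\ fam C, entourage E &
    forall y, (forall u, C u -> E (j x u, j y u)) -> B y]].
suff jG : j @ G --> j x.
  have [C [E [fC eE CEO]]] : G (j @^-1` O).
    exact: (jG O (open_nbhs_nbhs (conj oO Ox))).
  by exists C, E; split => // y /CEO; exact: OA.
have FG : Filter G.
  split=> [|B1 B2 [C1 [E1 [f1 e1 h1]]] [C2 [E2 [f2 e2 h2]]]|B1 B2 B12 [C [E [fC eE CE]]]].
  - by exists C0, setT; split => //; exact: entourageT.
  - have [C fC sC] := famU _ _ f1 f2; exists C, (E1 `&` E2).
    split=> // [|y yC]; first exact: filterI.
    split; [apply: h1 => u C1u|apply: h2 => u C2u].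
      by have [] := yC u (sC u (or_introl C1u)).
    by have [] := yC u (sC u (or_intror C2u)).
  - by exists C, E; split => // y /CE /B12.
apply/fam_cvgP => C fC P /uniform_nbhs[E [eE EP]].
by exists C, E; split => // y yE; exact: EP.
Qed.

End initial_family.

Section compact_open.
Context {R : realType} (k : scalar_kind) {X : metricType R} (x0 : X).
Local Notation K := (scalar_field R k).
Local Notation L := (lip0 x0 K^o).

Lemma nbhs_compact_open (f : lip0_compact_open k x0) (A : set L) :
  nbhs f A <-> exists C (e : R), [/\ compact C, 0 < e &
    forall g : L, (forall x, C x -> rnorm (f x - g x) < e) -> A g].
Proof.
have [||nA An] := @nbhs_initial_family L X K^o compact (@lip0_fun _ _ _ _ _) f A.
- by exists set0; exact: compact0.
- by move=> C D cC cD; exists (C `|` D) => //; exact: compactU.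
split=> [/nA[C [E [cC /entourage_rnorm[e e0 eE] CEA]]]|[C [e [cC e0 CeA]]]].
  by exists C, e; split => // g fg; apply: CEA => x Cx; apply: eE; exact: fg.
apply: An; exists C, [set p | rnorm (p.1 - p.2) < e]; split => //.
by apply/entourage_rnorm; exists e.
Qed.

End compact_open.

Section dual_topology.
Context {R : realType} {k : scalar_kind}.
Local Notation K := (scalar_field R k).
Context {F : normedModType K}.

Definition convex_balanced_compact : set (set F) :=
  [set C | [/\ @convex_set K F C, balanced C & compact C]].

Lemma convex_balanced_compact1 : convex_balanced_compact [set 0].
Proof.
split; last exact: compact_set1.
- by apply/convex_setE => x y t t0 t1 -> ->; rewrite /= !scaler0 addr0.
- by move=> a x _ ->; rewrite /= scaler0.
Qed.

Lemma convex_balanced_compactD (C D : set F) :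
  convex_balanced_compact C -> convex_balanced_compact D ->
  convex_balanced_compact [set p.1 + p.2 | p in C `*` D].
Proof.
move=> [cC bC kC] [cD bD kD]; split.
- apply/convex_setE => _ _ t t0 t1 [[a b] [/= Ca Db] <-] [[c d] [/= Cc Dd] <-].
  exists (t *: a + (1 - t) *: c, t *: b + (1 - t) *: d); last first.
    by rewrite /= !scalerDr addrACA.
  split; [exact: ((convex_setE C).1 cC)|exact: ((convex_setE D).1 cD)].
- move=> a _ a1 [[c d] [/= Cc Dd] <-]; exists (a *: c, a *: d).
    by split; [exact: bC|exact: bD].
  by rewrite /= scalerDr.
- apply: continuous_compact; last exact: compact_setX.
  by apply: continuous_subspaceT => x; exact: add_continuous.
Qed.

Lemma balanced0 (C : set F) : C !=set0 -> balanced C -> C 0.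
Proof. by move=> [x Cx] bC; rewrite -(scale0r x); apply: bC; rewrite ?normr0. Qed.

(** The compact sets C may be taken to contain 0, as the empty set can be
    replaced with the singleton of 0; the sum of two of them then contains
    both, which is the directedness. *)
Lemma nbhs_dual_c (psi : dual_c F) (A : set (dual F)) :
  nbhs psi A <-> exists C (e : R), [/\ convex_balanced_compact C, C 0, 0 < e &
    forall phi : dual F, (forall x, C x -> rnorm (psi x - phi x : K^o) < e) -> A phi].
Proof.
have [||nA An] := @nbhs_initial_family (dual F) F K^o
    convex_balanced_compact (@clin_fun _ _ _) psi A.
- by exists [set 0]; exact: convex_balanced_compact1.
- move=> C D fC fD.
  have [->|/set0P C0] := eqVneq C set0; first by exists D => //; rewrite set0U.
  have [->|/set0P D0] := eqVneq D set0; first by exists C => //; rewrite setU0.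
  exists [set p.1 + p.2 | p in C `*` D]; first exact: convex_balanced_compactD.
  have [[_ bC _] [_ bD _]] := (fC, fD).
  move=> x [Cx|Dx].
    by exists (x, 0); rewrite /= ?addr0//; split => //; exact: balanced0.
  by exists (0, x); rewrite /= ?add0r//; split => //; exact: balanced0.
split=> [/nA[C [E [fC /entourage_rnorm[e e0 eE] CEA]]]|[C [e [fC C0 e0 CeA]]]].
  exists (if C == set0 then [set 0] else C), e.
  case: eqVneq => [C0|/set0P C0]; split => //.
  - exact: convex_balanced_compact1.
  - by move=> g _; apply: CEA => x; rewrite C0.
  - by apply: balanced0 => //; case: fC.
  - by move=> g fg; apply: CEA => x Cx; apply: eE; exact: fg.
apply: An; exists C, [set p | rnorm (p.1 - p.2) < e]; split => //.
by apply/entourage_rnorm; exists e.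
Qed.

Lemma equicontinuous_dual (W : set (dual F)) :
  equicontinuous W (fun psi : dual_c F => clin_fun psi) <->
  exists2 M : R, 0 < M & forall psi x, W psi -> rnorm (psi x : K^o) <= M * rnorm x.
Proof.
split=> [eW|[M M0 WM] x E /entourage_rnorm[e e0 eE]]; last first.
  apply/nbhs_rnorm; exists (e / M) => [|y yx psi Wpsi]; first exact: divr_gt0.
  apply: eE; rewrite -dualB (le_lt_trans (WM _ _ Wpsi))//.
  by rewrite mulrC -ltr_pdivlMr// rnormB.
have e1 : entourage [set p : K^o * K^o | rnorm (p.1 - p.2) < (1 : R)].
  by apply/entourage_rnorm; exists 1.
have /nbhs_rnorm[d d0 dW] := eW 0 _ e1.
exists (2 / d) => [|psi x Wpsi]; first by rewrite divr_gt0.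
have [->|x0] := eqVneq x 0.
  by rewrite dual0 !rnorm0 mulr0.
have nx0 : 0 < rnorm x.
  rewrite lt_neqAle rnorm_ge0 andbT eq_sym; apply: contra_neq x0.
  exact: rnorm_eq0.
pose t := d / 2 / rnorm x.
have t0 : 0 < t by rewrite !divr_gt0.
have := dW (of_real k t *: x) _ psi Wpsi.
rewrite subr0 rnorm_of_realZ gtr0_norm// divfK ?gt_eqF//.
rewrite /= dual0 sub0r rnormN dualZ.
have -> : d / 2 < d by rewrite ltr_pdivrMr// mulr_natr mulr2n ltrDl.
move=> /(_ isT); rewrite rnormM rnorm_of_real gtr0_norm// => h.
apply: ltW; rewrite -(ltr_pM2l t0) (lt_le_trans h)// /t.
by rewrite le_eqVlt; apply/orP; left; apply/eqP; field; rewrite !gt_eqF.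
Qed.

End dual_topology.

Section eps_topology.
Context {R : realType} {k : scalar_kind}.
Local Notation K := (scalar_field R k).

Lemma entourage_lc_space (V : lmodType K) (B : lc_base V)
    (E : set (lc_space B * lc_space B)) :
  entourage E <-> exists2 U, lc_base_sets B U &
    forall x y : lc_space B, U (x - y) -> E (x, y).
Proof.
split=> [[A [[U BU UA] AE]]|[U BU UE]].
  exists U => // x y Uxy; apply/set_mem/AE/mem_set.
  by have := UA _ Uxy; rewrite add0r.
exists U; split; first by exists U => // u; rewrite add0r.
by move=> [x y] /set_mem Uxy; apply/mem_set/UE.
Qed.

(** The equicontinuous sets of functionals are cofinally the balls of the
    dual. *)
Lemma nbhs_eps_product (F : normedModType K) (V : lmodType K) (B : lc_base V)
    (T : eps_product (lc_space B) F) (A : set (eps_product (lc_space B) F)) :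
  nbhs T A <-> exists (M : R) U, [/\ 0 < M, lc_base_sets B U &
    forall S : eps_product (lc_space B) F,
      (forall psi : dual F, (forall x, rnorm (psi x : K^o) <= M * rnorm x) ->
        U (T psi - S psi)) -> A S].
Proof.
have [||nA An] := @nbhs_initial_family (eps_product (lc_space B) F) (dual F) (lc_space B)
    [set W | equicontinuous W (fun psi : dual_c F => clin_fun psi)]
    (@clin_fun _ _ _) T A.
- by exists set0 => x E eE; exact: nearW.
- move=> C D eC eD; exists (C `|` D) => // x E eE.
  by apply: filterS (filterI (eC x E eE) (eD x E eE)) => y [hC hD] i [/hC|/hD].
split=> [/nA[W [E [/equicontinuous_dual[M M0 WM] /entourage_lc_space[U BU UE] WEA]]]|].
  exists M, U; split => // S TS; apply: WEA => psi Wpsi; apply: UE; apply: TS.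
  by move=> x; exact: WM.
move=> [M [U [M0 BU MUA]]]; apply: An.
exists [set psi : dual F | forall x, rnorm (psi x : K^o) <= M * rnorm x].
exists [set p | U (p.1 - p.2)]; split.
- by apply/equicontinuous_dual; exists M => // psi x; apply.
- by apply/entourage_lc_space; exists U.
- by move=> S TS; apply: MUA => psi; exact: TS.
Qed.

End eps_topology.

(** * The mixed topology *)

Definition null_weights (R : realType) (alpha : R^nat) :=
  (forall n, 0 < alpha n) /\ alpha n @[n --> \oo] --> 0.

Section lipschitz.
Context {R : realType} {k : scalar_kind} {X : metricType R} {x0 : X}.
Local Notation K := (scalar_field R k).
Context {F : normedModType K}.
Implicit Types f g : lip0 x0 F.

Lemma slope_diag f p : p.1 = p.2 -> slope f p = 0.
Proof. by rewrite /slope => ->; rewrite subrr rnorm0 mul0r. Qed.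

Lemma slope_leP f p M : 0 <= M ->
  slope f p <= M <-> rnorm (f p.1 - f p.2) <= M * mdist p.1 p.2.
Proof.
move=> M0; have [pp|pX] := eqVneq p.1 p.2; last by rewrite slope_le.
by rewrite slope_diag// M0 pp subrr rnorm0 mulr_ge0 ?mdist_ge0.
Qed.

Lemma Lip_leP f M : 0 <= M -> Lip f <= M <-> forall p, slope f p <= M.
Proof.
move=> M0; rewrite Lip_le//; split=> h p; last by move=> _; exact: h.
by have [pp|pX] := eqVneq p.1 p.2; [rewrite slope_diag|exact: h].
Qed.

Lemma lip_scaled_ball (i : nat) f :
  [set (2 ^+ i : K) *: h | h in lip_ball x0 F] f <-> Lip f <= 2 ^+ i.
Proof.
have r2 : real_part `|2 ^+ i : K| = 2 ^+ i.
  rewrite ger0_norm ?exprn_ge0// -[RHS](@of_realK R k); congr real_part.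
  by case: k => //=; rewrite rmorphXn rmorph_nat.
have n2 : (2 ^+ i : K) != 0 by rewrite expf_neq0// pnatr_eq0.
have p2 : 0 <= 2 ^+ i :> R by exact: exprn_ge0.
rewrite (Lip_leP _ p2); split=> [[h /(Lip_leP _ ler01) hB <-] p|fB].
  by rewrite slopeZ r2 ler_piMr.
have fE : f = (2 ^+ i : K) *: ((2 ^+ i : K)^-1 *: f).
  by rewrite scalerA divff// scale1r.
exists ((2 ^+ i : K)^-1 *: f); last by rewrite -fE.
apply/(Lip_leP _ ler01) => p; have := fB p.
by rewrite {1}fE slopeZ r2 ger_pMr// exprn_gt0.
Qed.

Lemma slope_sublevel_convex I (w : I -> R) (p : I -> X * X) (M : R) :
  (forall i, 0 <= w i) ->
  @convex_set K (lip0 x0 F) [set f | forall i, w i * slope f (p i) <= M].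
Proof.
move=> w0; apply/convex_setE => f g t t0 t1 fM gM i /=.
have := ler_wpM2l (w0 i) (slopeD (t *: f) ((1 - t) *: g) (p i)).
move=> /le_trans; apply; rewrite !slopeZ mulrDr.
rewrite (ger0_norm t0) (@ger0_norm _ (1 - t)) ?subr_ge0//.
have -> : real_part (1 - t) = 1 - real_part t.
  by rewrite real_partD real_partN real_part1.
have h0 := real_part_ge0 t0; have h1 : real_part t <= 1.
  by rewrite -(@real_part1 R k) real_part_le.
by have := fM i; have := gM i => /=; rewrite !(mulrCA (w i)); nra.
Qed.

Lemma slope_sublevel_balanced I (w : I -> R) (p : I -> X * X) (M : R) :
  (forall i, 0 <= w i) ->
  balanced [set f : lip0 x0 F | forall i, w i * slope f (p i) <= M].
Proof.
move=> w0 a f a1 fM i /=; apply: le_trans (fM i).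
rewrite slopeZ ler_wpM2l// ler_piMl ?slope_ge0//.
by rewrite -(@real_part1 R k) real_part_le.
Qed.

(** Up to scaling, the unit balls of the null-weighted slope seminorms; the
    pairs may lie on the diagonal, where the slope vanishes, so that sequences
    of pairs exist over a one-point space too. *)
Definition slope_polar (alpha : R^nat) (p : nat -> X * X) : set (lip0 x0 F) :=
  [set f | forall n, alpha n * slope f (p n) <= 1].

Lemma null_slope_seminorm_ub alpha p f n : null_weights alpha ->
  alpha n * slope f (p n) <= null_slope_seminorm alpha p f.
Proof.
move=> [a0 acvg]; apply: ub_le_sup; last by exists n.
have [M M0 fM] := lip0_lipschitz f.
have /cvg_seq_bounded[N [_ aN]] : cvgn alpha by apply/cvg_ex; exists 0.
exists ((N + 1) * M) => _ [m _ <-].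
apply: ler_pM; [exact: ltW|exact: slope_ge0| |exact/(slope_leP _ _ M0)].
by rewrite (le_trans (ler_norm _))// aN// ltrDl.
Qed.

Lemma slope_polar_nbhs alpha p : null_weights alpha ->
  nbhs (0 : lip0_gamma_tau_gamma x0 F) (slope_polar alpha p).
Proof.
move=> aw; have [[q0 q0X]|nX] := pselect (exists q, @Xtilde R X q); last first.
  exists setT => [|f _ n].
    exists 0%N, (fun _ _ => 0), 1; split => [[]//|//|].
    by apply/seteqP; split => // v _ [].
  rewrite slope_diag ?mulr0//; apply/eqP/negP => /negP pX.
  by apply: nX; exists (p n).
(* pairs on the diagonal carry no condition; replace them by an admissible one *)
pose p' n := if (p n).1 == (p n).2 then q0 else p n.
exists [set f | forall i : 'I_1, null_slope_seminorm alpha p' f < 1].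
  exists 1%N, (fun=> null_slope_seminorm alpha p'), 1; split => // _.
  exists alpha, p'; split => //; [exact: aw.1|exact: aw.2|].
  by move=> n; rewrite /p'; case: eqVneq.
move=> f /(_ ord0) f1 n; rewrite add0r.
have [pp|pX] := eqVneq (p n).1 (p n).2; first by rewrite slope_diag// mulr0.
apply: ltW; apply: le_lt_trans f1.
by have := null_slope_seminorm_ub p' f n aw; rewrite /p' (negbTE pX).
Qed.

Lemma nbhs_slope_polars (f : lip0_gamma_tau_gamma x0 F) (A : set (lip0 x0 F)) :
  nbhs f A -> exists n (alpha : 'I_n -> R^nat) (p : 'I_n -> nat -> X * X),
    (forall i, null_weights (alpha i)) /\
    forall g : lip0 x0 F, (forall i, slope_polar (alpha i) (p i) (g - f)) -> A g.
Proof.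
move=> [U [n [q [e [Qq e0 ->]]]] UA].
have /choice[ap apP] : forall i, exists ap : R^nat * (nat -> X * X),
    null_weights ap.1 /\ q i = null_slope_seminorm ap.1 ap.2.
  move=> i; have [al [p [a0 ac pX ->]]] := Qq i.
  by exists (al, p).
(* the factor 2 / e makes the seminorm at most e / 2 on the polar, hence < e *)
exists n, (fun i m => 2 / e * (ap i).1 m), (fun i => (ap i).2); split.
  move=> i; have [[a0 ac] _] := apP i; split=> [m|]; first by rewrite !mulr_gt0// invr_gt0.
  by rewrite -(mulr0 (2 / e)); apply: cvgM => //; exact: cvg_cst.
move=> g gP; have <- : (f : lip0 x0 F) + (g - f) = g by rewrite addrC subrK.
apply: UA => i /=.
rewrite (apP i).2; apply: (@le_lt_trans _ _ (e / 2)); last by lra.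
apply: ge_sup; first by exists ((ap i).1 0%N * slope (g - f) ((ap i).2 0%N)), 0%N.
move=> _ [m _ <-]; have e2 : 0 < 2 / e by rewrite divr_gt0.
rewrite -(ler_pM2l e2) (_ : 2 / e * (e / 2) = 1); last by field; rewrite gt_eqF.
by have := gP i m; rewrite -(mulrA (2 / e)).
Qed.

End lipschitz.

Section scalar_lipschitz.
Context {R : realType} {k : scalar_kind} {X : metricType R} {x0 : X}.
Local Notation K := (scalar_field R k).
Local Notation L := (lip0 x0 K^o).

Lemma slope_near0 (p : X * X) (e : R) : 0 < e ->
  nbhs (0 : lip0_compact_open k x0) [set f : L | slope f p <= e].
Proof.
move=> e0; have [pp|pX] := eqVneq p.1 p.2.
  by apply: (@filterS _ (nbhs (0 : lip0_compact_open k x0)) _ setT) => [f _|];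
     [rewrite /= slope_diag// ltW|exact: filterT].
have d0 : 0 < mdist p.1 p.2 by rewrite mdist_gt0.
apply/nbhs_compact_open; exists [set p.1; p.2], (e * mdist p.1 p.2 / 2); split.
- exact/finite_compact/finite_set2.
- by rewrite divr_gt0// mulr_gt0.
- move=> f f0; apply/(slope_leP _ _ (ltW e0)).
  have f1 : rnorm (0 - f p.1) < _ := f0 p.1 (or_introl erefl).
  have f2 : rnorm (0 - f p.2) < _ := f0 p.2 (or_intror erefl).
  rewrite (le_trans (rnorm_triangle _ 0 _))// (rnormB (f p.1)).
  by move: f1 f2; lra.
Qed.

(** A pair of points is a compact set, so slopes depend continuously on f. *)
Lemma closed_slope_le (p : X * X) (M : R) :
  closed [set f : lip0_compact_open k x0 | slope f p <= M].
Proof.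
move=> f clf /=; have [pp|pX] := eqVneq p.1 p.2.
  have [g [+ _]] := clf setT filterT.
  by rewrite /= !slope_diag.
have d0 : 0 < mdist p.1 p.2 by rewrite mdist_gt0.
apply/ler_addgt0Pr => e e0.
have [|g [/= gM fg]] := clf [set g | forall x, [set p.1; p.2] x ->
    rnorm (f x - g x) < e * mdist p.1 p.2 / 2].
  apply/nbhs_compact_open; exists [set p.1; p.2], (e * mdist p.1 p.2 / 2); split => //.
    exact/finite_compact/finite_set2.
  by rewrite divr_gt0// mulr_gt0.
have f1 := fg p.1 (or_introl erefl); have f2 := fg p.2 (or_intror erefl).
rewrite slope_le// mulrDl; move: gM; rewrite slope_le// => gM.
have := rnorm_triangle (f p.1) (g p.1) (f p.2).
have := rnorm_triangle (g p.1) (g p.2) (f p.2).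
by rewrite (rnormB (g p.2)); lra.
Qed.

Lemma lip_ball_equicontinuous (r : R) :
  equicontinuous [set lip0_fun f | f in [set f : L | Lip f <= r]]
    (id : (X -> K^o) -> X -> K^o).
Proof.
move=> x E /entourage_rnorm[e e0 eE].
have r1 : 0 < `|r| + 1 by rewrite ltr_wpDl.
have : nbhs x (ball x (e / (`|r| + 1))) by apply: nbhsx_ballx; rewrite divr_gt0.
apply: filterS => y; rewrite ballEmdist /= => xy _ [f fr <-]; apply: eE.
have fr1 : Lip f <= `|r| + 1 by rewrite (le_trans fr)// (le_trans (ler_norm _))// lerDl.
have := (Lip_leP f (ltW r1)).1 fr1 (x, y) => /(slope_leP _ _ (ltW r1)).
by move=> /le_lt_trans; apply; rewrite mulrC -ltr_pdivlMr.
Qed.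

Lemma lip_ball_pointwise_precompact (r : R) :
  pointwise_precompact [set lip0_fun f | f in [set f : L | Lip f <= r]]
    (id : (X -> K^o) -> X -> K^o).
Proof.
move=> x; apply: (@precompact_subset _ _ [set a : K^o | rnorm a <= `|r| * mdist x x0]).
  move=> _ [_ [f fr <-] <-] /=; have r0 := normr_ge0 r.
  have := (Lip_leP f r0).1 (le_trans fr (ler_norm _)) (x, x0).
  by move=> /(slope_leP _ _ r0); rewrite /= lip0_base subr0.
by rewrite precompact_closed; [exact: compact_disc|exact: closed_disc].
Qed.

(** Lipschitz balls are compact for uniform convergence on compact sets, by
    the theorem of Ascoli: pointwise limits keep the base point and the
    Lipschitz constant. *)
Lemma compact_lip_ball (r : R) : 0 <= r ->
  compact [set f : lip0_compact_open k x0 | Lip f <= r].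
Proof.
move=> r0 G FG Gr; pose W := [set lip0_fun f | f in [set f : L | Lip f <= r]].
have := @pointwise_precompact_equicontinuous X K^o (@norm_hausdorff _ _) W
  (@lip_ball_pointwise_precompact r) (@lip_ball_equicontinuous r).
rewrite precompactE => cW.
pose H : set_system {family compact, X -> K^o} := (@lip0_fun _ _ _ _ _) @ G.
have [|g [_ Hg]] := cW H _.
  apply: (@filterS _ G _ _ _ _ Gr) => f fr; apply: subset_closure.
  by exists f.
have near_g (A : set L) C e : G A -> compact C -> 0 < e ->
    exists2 f : L, A f & forall x, C x -> rnorm (g x - f x) < e.
  move=> GA cC e0.
  have eE : entourage [set q : K^o * K^o | rnorm (q.1 - q.2) < e].
    by apply/entourage_rnorm; exists e.
  have [|_ [[f Af <-] fC]] := Hg [set lip0_fun f | f in A] _ _ (fam_nbhs g eE cC).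
    by apply: (@filterS _ G _ _ _ _ GA) => f Af; exists f.
  by exists f.
have gr x y : rnorm (g x - g y) <= r * mdist x y.
  apply/ler_addgt0Pr => e e0; have e2 : 0 < e / 2 by rewrite divr_gt0.
  have [|f fr fg] := near_g _ [set x; y] _ Gr _ e2.
    exact/finite_compact/finite_set2.
  have f1 := fg x (or_introl erefl); have f2 := fg y (or_intror erefl).
  have := (Lip_leP f r0).1 fr (x, y) => /(slope_leP _ _ r0) /=.
  have := rnorm_triangle (g x) (f x) (g y).
  have := rnorm_triangle (f x) (f y) (g y).
  by rewrite (rnormB (f y)); lra.
have g0 : g x0 = 0.
  apply: (@rnorm_eq0 R k K^o); apply/eqP; rewrite eq_le rnorm_ge0 andbT.
  apply/ler_addgt0Pr => e e0; rewrite add0r.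
  have [f _ fg] := near_g _ [set x0] _ Gr (@compact_set1 _ x0) e0.
  by have := fg x0 erefl; rewrite lip0_base subr0 => /ltW.
have gP : g \in lip0_pred x0 K^o by apply/asboolP; split => //; exists r.
exists (Lip0 gP); split.
  by apply/(Lip_leP _ r0) => p; apply/(slope_leP _ _ r0); exact: gr.
move=> A B GA /nbhs_compact_open[C [e [cC e0 CeB]]].
have [f Af fg] := near_g A C e GA cC e0.
by exists f; split => //; exact: CeB.
Qed.

End scalar_lipschitz.

Section mixed_topology_polars.
Context {R : realType} {k : scalar_kind} {X : metricType R} {x0 : X}.
Local Notation K := (scalar_field R k).
Local Notation L := (lip0 x0 K^o).

Lemma sum_halves_le1 n : \sum_(i < n) (2^-1 : R) ^+ i.+1 <= 1.
Proof.
suff -> : \sum_(i < n) (2^-1 : R) ^+ i.+1 = 1 - (2^-1 : R) ^+ n.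
  by rewrite gerBl exprn_ge0 ?invr_ge0.
elim: n => [|n IH]; first by rewrite big_ord0 expr0 subrr.
by rewrite big_ord_recr/= IH exprS; lra.
Qed.

(** In a sum of terms g_i with slopes at most 2^i, all but finitely many of the
    weights make the i-th term small; the other weights ask for smallness at
    finitely many pairs, which is a neighbourhood for compact convergence. *)
Lemma slope_polar_tau_gamma alpha p : null_weights alpha ->
  nbhs (0 : lip0_tau_gamma k x0) (slope_polar alpha p).
Proof.
move=> [a0 ac]; pose h i : R := 2^-1 ^+ i.+1.
have h0 i : 0 < h i by rewrite exprn_gt0 ?invr_gt0.
(* h i is the share of the i-th term; the shares add up to at most 1 *)
have /choice[N NP] : forall i, exists N, forall n, (N <= n)%N ->
    alpha n * 2 ^+ i <= h i.
  move=> i; have e0 : 0 < h i / 2 ^+ i by rewrite divr_gt0// exprn_gt0.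
  have /cvgrPdist_lt/(_ _ e0)[N _ NP] := ac.
  exists N => n /NP; rewrite sub0r normrN gtr0_norm// ltr_pdivlMr ?exprn_gt0//.
  exact: ltW.
pose U i : set L := [set f | forall n : 'I_(N i), alpha n * slope f (p n) <= h i].
exists (gamma_set U).
  exists U => // i; split.
  - by apply: slope_sublevel_convex => n; exact: ltW.
  - by apply: slope_sublevel_balanced => n; exact: ltW.
  - apply: (@filter_forall _ _ _ (nbhs (0 : lip0_compact_open k x0))) => n.
    have e0 : 0 < h i / alpha n by rewrite divr_gt0.
    apply: (@filterS _ (nbhs (0 : lip0_compact_open k x0)) _ _ _ _ (slope_near0 (p n) e0)).
    by move=> f /=; rewrite ler_pdivlMr// mulrC.
move=> _ [m [g [gU ->]]] n; rewrite add0r.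
have small i : (i <= m)%N -> alpha n * slope (g i) (p n) <= h i.
  move=> im; have [Ui /lip_scaled_ball Bi] := gU i im.
  have [nN|Nn] := ltnP n (N i); first exact: (Ui (Ordinal nN)).
  apply: le_trans (NP i n Nn); apply: ler_wpM2l; first exact: ltW.
  have p2 : 0 <= 2 ^+ i :> R by exact: exprn_ge0.
  exact: ((Lip_leP _ p2).1 Bi).
apply: le_trans (sum_halves_le1 m.+1).
have : slope (\sum_(i < m.+1) g i) (p n) <= \sum_(i < m.+1) slope (g i) (p n).
  elim/big_rec2: _ => [|i y f _ fy].
    by rewrite /slope subrr rnorm0 mul0r.
  by rewrite (le_trans (slopeD _ _ _))// lerD2l.
move=> /(ler_wpM2l (ltW (a0 n))) /le_trans; apply; rewrite mulr_sumr.
by apply: ler_sum => i _; apply: small; rewrite -ltnS.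
Qed.

(** On Lipschitz balls the mixed topology is coarser than compact convergence:
    a function with Lipschitz constant at most 2^i that lies in the i-th
    neighbourhood is by itself an element of the mixed neighbourhood. *)
Lemma tau_gamma_coarser_on_balls (f : lip0_tau_gamma k x0) (A : set L) (r : R) :
  nbhs f A -> Lip (f : L) <= r -> exists2 B, nbhs (f : lip0_compact_open k x0) B &
    forall g, B g -> Lip g <= r -> A g.
Proof.
move=> [_ [V gV ->] VA] fr.
have r1 : 0 <= `|r| by [].
have [i ri] := exp2_unbounded (2 * `|r|).
have [_ _ /nbhs_compact_open[C [e [cC e0 CeV]]]] := gV i.
exists [set g : L | forall x, C x -> rnorm (f x - g x) < e].
  by apply/nbhs_compact_open; exists C, e.
move=> g fg gr; have <- : (f : L) + (g - f) = g by rewrite addrC subrK.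
apply: VA; exists i, (fun j => if j == i then g - (f : L) else 0); split; last first.
  rewrite big_ord_recr/= eqxx big1 ?add0r// => j _.
  by rewrite (ltn_eqF (ltn_ord j)).
move=> j _; case: eqVneq => [->|_]; split.
- apply: CeV => x Cx; have -> : (0 : L) x - (g - (f : L)) x = f x - g x.
    by rewrite sub0r opprB.
  exact: fg.
- apply/lip_scaled_ball/Lip_leP => [|q]; first exact: exprn_ge0.
  rewrite (le_trans (slopeD _ _ _))//.
  have -> : slope (- (f : L)) q = slope (f : L) q.
    by rewrite -scaleN1r slopeZ normrN normr1 real_part1 mul1r.
  apply: le_trans ri; rewrite mulr_natl mulr2n lerD//.
    exact: (Lip_leP _ r1).1 (le_trans gr (ler_norm _)) q.
  exact: (Lip_leP _ r1).1 (le_trans fr (ler_norm _)) q.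
- by have [_ _ n0] := gV j; exact: (nbhs_singleton n0).
- apply/lip_scaled_ball/Lip_leP => [|q]; first exact: exprn_ge0.
  by rewrite /slope subrr rnorm0 mul0r exprn_ge0.
Qed.

Definition slope_tests (l : seq (R * (X * X))) : set L :=
  [set f | forall q, q \in l -> slope f q.2 <= q.1].

(** By compactness: otherwise, for every finite set S of pairs, some function
    in the ball of radius s passes the tests for S but lies outside W. These
    functions cluster at one that passes the test slope f p <= r for every p,
    hence lies in the ball of radius r and in W, although W is relatively open
    in the larger ball. *)
Lemma finitely_many_tests (W : set L) (r s : R) l : 0 <= r -> r <= s ->
  (forall f, W f -> Lip f <= s -> exists2 B, nbhs (f : lip0_compact_open k x0) B &
    forall g, B g -> Lip g <= s -> W g) ->
  (forall f, Lip f <= r -> slope_tests l f -> W f) ->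
  exists S : seq (X * X), forall f, Lip f <= s ->
    slope_tests (l ++ [seq (r, p) | p <- S]) f -> W f.
Proof.
move=> r0 rs oW rW; apply: contrapT => noS.
pose bad S : set (lip0_compact_open k x0) :=
  [set f | [/\ Lip (f : L) <= s, slope_tests (l ++ [seq (r, p) | p <- S]) f & ~ W f]].
have bad_neq0 S : bad S !=set0.
  apply: contrapT => b0; apply: noS; exists S => f fs fS.
  by apply: contrapT => nW; apply: b0; exists f.
pose G := filter_from [set: seq (X * X)] bad.
have FG : ProperFilter G.
  apply: filter_from_proper; last by move=> S _; exact: bad_neq0.
  apply: filter_from_filter; first by exists [::].
  move=> S T _ _; exists (S ++ T) => // f [fs fST nW].
  split; split=> // q; rewrite mem_cat => qS; apply: fST; rewrite mem_cat map_cat mem_cat.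
    by case/orP: qS => ->; rewrite ?orbT.
  by case/orP: qS => ->; rewrite ?orbT.
have s0 : 0 <= s by rewrite (le_trans r0).
have Gs : G [set f | Lip (f : L) <= s] by exists [::] => // f [].
have [f [fs Gf]] := compact_lip_ball s0 FG Gs.
have test q S : q \in l ++ [seq (r, p) | p <- S] -> slope (f : L) q.2 <= q.1.
  move=> qS; apply: (@closed_slope_le _ k _ x0 q.2 q.1) => B nB; apply: Gf => //.
  by exists S => // g [_ gS _]; exact: gS.
have Wf : W f.
  apply: rW; first apply/(Lip_leP _ r0) => p.
    by apply: (test (r, p) [:: p]); rewrite mem_cat inE eqxx orbT.
  by move=> q ql; apply: (test q [::]); rewrite mem_cat ql.
have [B nB BW] := oW f Wf fs.
have [|g [[gs _ nW] Bg]] := Gf (bad [::]) B _ nB; first by exists [::].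
exact/nW/BW.
Qed.

(** All the tests of all the levels become one sequence: the index m codes a
    level n and a position j in its list S n, and the indices that code
    nothing get harmonic weights. *)
Lemma null_enumeration (T : eqType) (t0 : T) (S : nat -> seq T) (a : R^nat) :
  null_weights a -> exists (alpha : R^nat) (p : nat -> T), null_weights alpha /\
    forall n t, t \in S n -> exists m, alpha m = a n /\ p m = t.
Proof.
move=> [a0 ac].
pose hit m := if (pickle_inv m : option (nat * nat)) is Some (n, j)
  then if (j < size (S n))%N then Some (n, j) else None else None.
exists (fun m => if hit m is Some (n, _) then a n else harmonic m).
exists (fun m => if hit m is Some (n, j) then nth t0 (S n) j else t0).
split; last first.
  move=> n t tS; exists (pickle (n, index t (S n))).
  by rewrite /hit pickleK_inv index_mem tS nth_index.
split=> [m|]; first by case: (hit m) => [[]|] => //; exact: harmonic_gt0.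
apply/cvgrPdist_lt => e e0.
have /cvgrPdist_lt/(_ e e0)[N _ aN] := ac.
have /cvgrPdist_lt/(_ e e0)[N' _ hN] := @cvg_harmonic R.
(* beyond M every index that codes a test has a level at least N *)
pose M := (\max_(n < N) \max_(j < size (S n)) pickle (n : nat, j : nat))%N.
exists (maxn N' M.+1) => // m /=; rewrite geq_max => /andP[N'm Mm].
case E : (hit m) => [[n j]|]; last exact: hN.
have [nN|Nn] := ltnP n N; last exact: aN.
exfalso; move: E; rewrite /hit.
have := @pickle_invK (nat * nat)%type m.
case: pickle_inv => [[n' j']|]//= mE; case: ltnP => // j'S [nE jE].
move: Mm; rewrite ltnNge => /negP; apply; subst n' j'; rewrite -mE.
rewrite (leq_trans _ (leq_bigmax (Ordinal nN)))//=.
exact: (leq_bigmax (F := fun j : 'I_(size (S n)) => pickle (n, j : nat)) (Ordinal j'S)).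
Qed.

Lemma compact_bounded_mdist (C : set X) : compact C ->
  exists2 D : R, 0 < D & forall x, C x -> mdist x x0 <= D.
Proof.
move=> cC; have cd : continuous (fun x => mdist x x0 : R^o).
  move=> x; apply/cvgrPdist_lt => e e0.
  have : nbhs x (ball x e) by exact: nbhsx_ballx.
  apply: filterS => y; rewrite ballEmdist /= => xy.
  have := metric_triangle x0 x y; have := metric_triangle x0 y x.
  rewrite (metric_sym y x) ltr_norml.
  by rewrite !(metric_sym x0); lra.
have : compact ((fun x => mdist x x0 : R^o) @` C).
  by apply: continuous_compact => //; exact: continuous_subspaceT.
move=> /compact_bounded[N [_ NC]].
exists (`|N| + 1) => [|x Cx]; first by rewrite ltr_wpDl.
have := NC (`|N| + 1); rewrite (le_lt_trans (ler_norm _)) ?ltrDl// => /(_ isT).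
move=> /(_ (mdist x x0)) /(_ (ex_intro2 _ _ x Cx erefl)).
by rewrite /= ger0_norm ?mdist_ge0.
Qed.

(** The argument of Banach and Dieudonne: going from the ball of radius r n to
    the twice larger one costs finitely many tests of weight 1 / r n, and the
    weights tend to 0. *)
Lemma tau_gamma_slope_polar (A : set L) : nbhs (0 : lip0_tau_gamma k x0) A ->
  exists alpha p, null_weights alpha /\ slope_polar alpha p `<=` A.
Proof.
move=> nA; pose W : set L := [set f | nbhs (f : lip0_tau_gamma k x0) A].
have WA : W `<=` A by move=> f; exact: nbhs_singleton.
have oW (s : R) f : W f -> Lip f <= s ->
    exists2 B, nbhs (f : lip0_compact_open k x0) B & forall g, B g -> Lip g <= s -> W g.
  move=> Wf; apply: tau_gamma_coarser_on_balls.
  exact: (@nbhs_interior (lip0_tau_gamma k x0)).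
have z0 (s : R) : 0 <= s -> Lip (0 : L) <= s.
  by move=> s0; apply/(Lip_leP _ s0) => q; rewrite /slope subrr rnorm0 mul0r.
(* the ball from which the enlargement starts *)
have [d d0 dW] : exists2 d, 0 < d & forall f : L, Lip f <= d -> W f.
  have [B /nbhs_compact_open[C [e [cC e0 CeB]]] BW] := oW 1 0 nA (z0 _ ler01).
  have [D D0 CD] := compact_bounded_mdist cC.
  pose d := Num.min 1 (e / (2 * D)).
  have d0 : 0 < d by rewrite lt_min ltr01 divr_gt0// mulr_gt0.
  exists d => // f fd; apply: BW; last by rewrite (le_trans fd)// ge_min lexx.
  apply: CeB => x Cx; rewrite -rnormN opprB.
  have := (Lip_leP f (ltW d0)).1 fd (x, x0) => /(slope_leP _ _ (ltW d0)) /=.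
  rewrite lip0_base => /le_lt_trans; apply.
  apply: (@le_lt_trans _ _ (e / (2 * D) * D)).
    apply: ler_pM; rewrite ?mdist_ge0 ?(ltW d0) ?CD//.
    by rewrite ge_min lexx orbT.
  rewrite (_ : e / (2 * D) * D = e / 2); first by lra.
  by field; rewrite gt_eqF.
pose r n : R := d * 2 ^+ n.
have r0 n : 0 < r n by rewrite mulr_gt0// exprn_gt0.
pose inv n l := forall f : L, Lip f <= r n -> slope_tests l f -> W f.
have /choice[T TP] : forall nl : nat * seq (R * (X * X)), exists S : seq (X * X),
    inv nl.1 nl.2 -> inv nl.1.+1 (nl.2 ++ [seq (r nl.1, p) | p <- S]).
  move=> [n l] /=; have [nl|] := pselect (inv n l); last by exists [::].
  have rn : r n <= r n.+1 by rewrite /r exprS ler_pM2l// ler_peMl ?exprn_ge0// ler1n.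
  have [S SP] := finitely_many_tests (ltW (r0 n)) rn (oW _) nl.
  by exists S.
pose l := fix l n := if n is m.+1 then l m ++ [seq (r m, p) | p <- T (m, l m)] else [::].
have invl n : inv n (l n).
  elim: n => [|n IH]; last exact: (TP (n, l n) IH).
  by move=> f fd _; apply: dW; move: fd; rewrite /r expr0 mulr1.
have rV : null_weights (fun n => (r n)^-1).
  split=> [n|]; first by rewrite invr_gt0.
  have -> : (fun n => (r n)^-1) = (fun n => d^-1 * 2^-1 ^+ n).
    by apply/funext => n; rewrite /r invfM exprVn.
  rewrite -(mulr0 d^-1); apply: cvgM; first exact: cvg_cst.
  by apply: cvg_expr; rewrite ger0_norm; lra.
have [alpha [p [aw ap]]] := null_enumeration (x0, x0) (fun n => T (n, l n)) rV.
exists alpha, p; split => // f fP; apply: WA.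
have [M M0 fM] := lip0_lipschitz f.
have [n Mn] : exists n, M <= r n.
  by have [n Mn] := exp2_unbounded (M / d); exists n; rewrite /r mulrC -ler_pdivrMr.
apply: (invl n).
  apply/(Lip_leP _ (ltW (r0 n))) => q; rewrite (le_trans _ Mn)//.
  exact/(slope_leP _ _ M0).
elim: n {Mn} => [|n IH] q //=; rewrite mem_cat => /orP[|/mapP[t tT ->]]; first exact: IH.
have [m [am pm]] := ap n t tT.
by have := fP m; rewrite am pm ler_pdivrMl// mulr1.
Qed.

End mixed_topology_polars.

(** * Functionals continuous for convergence on compact sets *)

Section representation.
Context {R : realType} {k : scalar_kind}.
Local Notation K := (scalar_field R k).
Context {F : normedModType K}.

Lemma continuous_real_part_dual (psi : dual F) :
  continuous (fun x => real_part (psi x) : R^o).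
Proof.
have [N N0 psiN] := dual_bounded psi.
move=> x; apply/cvgrPdist_lt => e e0; apply/nbhs_rnorm.
exists (e / N) => [|y]; first exact: divr_gt0.
rewrite ltr_pdivlMr// mulrC => yx.
have {}psiN a : real_part (psi a) <= N * rnorm a.
  exact: le_trans (real_part_le_norm _) (psiN a).
have := psiN (y - x); have := psiN (x - y).
by rewrite (rnormB x) !dualB !real_partD !real_partN ltr_norml; lra.
Qed.

Variables (phi : dual F -> K^o) (C : set F).
Hypotheses (phi_linear : linear phi) (cbkC : convex_balanced_compact C) (C0 : C 0).
Hypothesis phi_bound : forall (psi : dual F) (M : R), 0 < M ->
  (forall c, C c -> rnorm (psi c : K^o) <= M) -> rnorm (phi psi) <= M.

Let phi0 : phi 0 = 0.
Proof.
by have := phi_linear (-1) 0 0; rewrite scaleN1r oppr0 addr0 scaleN1r addNr.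
Qed.

Let phiZ a (psi : dual F) : phi (a *: psi) = a * phi psi.
Proof. by have := phi_linear a psi 0; rewrite phi0 !addr0. Qed.

Let phiD (psi chi : dual F) : phi (psi + chi) = phi psi + phi chi.
Proof. by have := phi_linear 1 psi chi; rewrite !scale1r. Qed.

(** A nearest-point argument: at a point of C that minimises the distance
    between the two tuples of values, the residues v are the coefficients of a
    functional that attains its supremum over C there, and the bound on phi
    makes the sum of the squares of the residues nonpositive. *)
Lemma finite_representation (s : seq (dual F)) :
  exists2 c, C c & forall psi : dual F, psi \in s ->
    real_part (phi psi) = real_part (psi c).
Proof.
have [cC bC kC] := cbkC.
pose dist2 c := \sum_(psi <- s) (real_part (phi psi) - real_part (psi c)) ^+ 2.
have cdist : continuous (dist2 : F -> R^o).
  rewrite {}/dist2; elim: s => [|psi s' IH] x.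
    rewrite (_ : (fun _ => _) = fun=> 0); first exact: cvg_cst.
    by apply/funext => c; rewrite big_nil.
  rewrite (_ : (fun _ => _) = fun c => (real_part (phi psi) - real_part (psi c)) ^+ 2 +
      \sum_(psi <- s') (real_part (phi psi) - real_part (psi c)) ^+ 2); last first.
    by apply/funext => c; rewrite big_cons.
  apply: cvgD; last exact: IH.
  have h : (real_part (phi psi) - real_part (psi y) : R^o) @[y --> x] -->
      (real_part (phi psi) - real_part (psi x) : R^o).
    by apply: cvgB; [exact: cvg_cst|exact: continuous_real_part_dual].
  exact: (cvgM h h).
have Cn0 : C !=set0 by exists 0.
have [c0 /set_mem Cc0 minc0] :=
  compact_EVT_min Cn0 kC (continuous_subspaceT cdist).
pose v psi := real_part (phi psi) - real_part (psi c0).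
pose Psi : dual F := \sum_(psi <- s) of_real k (v psi) *: psi.
have PsiE c : real_part (Psi c) = \sum_(psi <- s) v psi * real_part (psi c).
  have -> : real_part (Psi c) =
      \sum_(psi <- s) real_part ((of_real k (v psi) *: psi) c).
    apply: (big_morph (fun chi : dual F => real_part (chi c))).
      by move=> f g; rewrite -real_partD.
    exact: real_part0.
  by apply: eq_bigr => psi _; rewrite -real_part_of_realM.
have PsiC c : C c -> real_part (Psi c) <= real_part (Psi c0).
  move=> Cc; pose w (psi : dual F) := real_part (psi c) - real_part (psi c0).
  pose A := \sum_(psi <- s) v psi * w psi; pose B := \sum_(psi <- s) w psi ^+ 2.
  have AE : A = real_part (Psi c) - real_part (Psi c0).
    by rewrite !PsiE -sumrB; apply: eq_bigr => psi _; rewrite -mulrBr.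
  have B0 : 0 <= B by rewrite sumr_ge0// => psi _; exact: sqr_ge0.
  have AB t : 0 < t -> t <= 1 -> 2 * A <= t * B.
    move=> t0 t1; pose T := of_real k t.
    have Ct : C (T *: c + (1 - T) *: c0).
      apply: ((convex_setE C).1 cC) => //; first by rewrite /T -of_real0 of_real_le// ltW.
      by rewrite /T -of_real1 of_real_le.
    have := minc0 _ (mem_set Ct).
    (* first variation of dist2 at its minimum, along the segment from c0 to c *)
    have -> : dist2 (T *: c + (1 - T) *: c0) = dist2 c0 - 2 * t * A + t ^+ 2 * B.
      rewrite /dist2 /A /B !mulr_sumr -sumrB -big_split/=; apply: eq_bigr => psi _.
      have -> : T *: c + (1 - T) *: c0 = c0 - T *: (c0 - c).
        by rewrite scalerBl scale1r scalerBr opprB addrC -addrA [- _ + _]addrC.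
      rewrite dualB dualZ dualB !(real_partD, real_partN, real_part_of_realM).
      by rewrite /w -/(v psi) /v; ring.
    rewrite -addrA lerDl => h.
    by rewrite -(ler_pM2l t0); move: h; rewrite expr2; lra.
  rewrite -subr_le0 -AE leNgt; apply/negP => A0.
  (* a step t that is small enough to contradict 2 A <= t B when A > 0 *)
  pose t := Num.min 1 (A / (B + 1)).
  have B1 : 0 < B + 1 by rewrite ltr_wpDl.
  have t0 : 0 < t by rewrite lt_min ltr01 divr_gt0.
  have t1 : t <= 1 by rewrite ge_min lexx.
  have tA : t * (B + 1) <= A by rewrite -ler_pdivlMr// ge_min lexx orbT.
  by have := AB t t0 t1; nra.
pose m := real_part (Psi c0).
have m0 : 0 <= m by have := PsiC 0 C0; rewrite dual0 real_part0.
have Psim c : C c -> rnorm (Psi c : K^o) <= m.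
  move=> Cc; have [a a1 aE] := rotate_norm (Psi c).
  have := PsiC (a *: c) (bC a c a1 Cc).
  by rewrite dualZ aE of_realK.
have phim : real_part (phi Psi) <= m.
  apply: (le_trans (real_part_le_norm _)); apply/ler_addgt0Pr => e e0.
  apply: phi_bound => [|c /Psim cm]; first by rewrite ltr_wpDl.
  by rewrite (le_trans cm)// lerDl ltW.
have phiPsi : real_part (phi Psi) = \sum_(psi <- s) v psi ^+ 2 + m.
  have -> : real_part (phi Psi) =
      \sum_(psi <- s) real_part (phi (of_real k (v psi) *: psi)).
    apply: (big_morph (fun chi : dual F => real_part (phi chi))).
      by move=> f g; rewrite phiD real_partD.
    by rewrite phi0 real_part0.
  rewrite /m PsiE -big_split/=; apply: eq_bigr => psi _.
  by rewrite phiZ real_part_of_realM /v; ring.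
have v0 : \sum_(psi <- s) v psi ^+ 2 == 0.
  rewrite eq_le [X in _ && X]sumr_ge0 ?andbT//; last by move=> psi _; exact: sqr_ge0.
  by move: phim; rewrite phiPsi gerDr.
exists c0 => // psi psis; apply/eqP; rewrite -subr_eq0 -sqrf_eq0.
move: v0; rewrite psumr_eq0; last by move=> chi _; exact: sqr_ge0.
by move=> /allP/(_ _ psis).
Qed.

(** The instance of the Mackey-Arens theorem that is needed: compactness of C
    turns the finite representations into a single one. *)
Lemma representation : exists2 c, C c & forall psi, phi psi = psi c.
Proof.
have [cC bC kC] := cbkC.
pose rep (s : seq (dual F)) := [set c | C c /\
  forall psi : dual F, psi \in s -> real_part (phi psi) = real_part (psi c)].
pose G := filter_from [set: seq (dual F)] rep.
have FG : ProperFilter G.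
  apply: filter_from_proper => [|s _]; last first.
    by have [c Cc cs] := finite_representation s; exists c.
  apply: filter_from_filter; first by exists [::].
  move=> s t _ _; exists (s ++ t) => // c [Cc cst].
  by split; split=> // psi psis; apply: cst; rewrite mem_cat psis ?orbT.
have GC : G C by exists [::] => // c [].
have [c [Cc Gc]] := kC G FG GC.
(* real parts determine phi psi when tested on all the multiples of psi *)
exists c => // psi; apply: real_part_eq => a.
rewrite -phiZ -dualZ.
have -> : psi (a *: c) = (a *: psi) c by rewrite dualZ.
set chi := a *: psi; apply/eqP; rewrite -subr_eq0 -normr_le0.
apply/ler_addgt0Pr => e e0; rewrite add0r.
have /cvgrPdist_lt/(_ e e0) ce := @continuous_real_part_dual chi c.
have [|d [[_ dchi] cd]] := Gc (rep [:: chi]) _ _ ce; first by exists [:: chi].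
by move: cd => /=; rewrite -(dchi chi) ?inE// distrC => /ltW.
Qed.

End representation.

(** * The transpose map *)

Section lc_space_nbhs.
Context {R : realType} {k : scalar_kind} {V : lmodType (scalar_field R k)}.
Context {B : lc_base V}.

Lemma nbhs_lc_shift (x : lc_space B) (A : set V) :
  nbhs x A <-> nbhs (0 : lc_space B) [set u | A (x + u)].
Proof.
by split=> -[U BU UA]; exists U => // u /UA; rewrite add0r.
Qed.

Lemma nbhs_lc_base (U : set V) : lc_base_sets B U -> nbhs (0 : lc_space B) U.
Proof. by move=> BU; exists U => // u; rewrite add0r. Qed.

End lc_space_nbhs.

Section transpose_isomorphism.
Context {R : realType} {k : scalar_kind} {X : metricType R} {x0 : X}.
Local Notation K := (scalar_field R k).
Context {F : completeNormedModType K}.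
Local Notation L := (lip0 x0 K^o).
Local Notation E := (eps_product (lip0_tau_gamma k x0) F).
Implicit Types (f g : lip0 x0 F) (psi : dual F) (alpha : R^nat).

Lemma lip0_ext (G : normedModType K) (f g : lip0 x0 G) : f =1 g -> f = g.
Proof. by move=> fg; apply: val_inj; apply/funext. Qed.

Lemma transposeDZ f a psi chi :
  transpose f (a *: psi + chi) = a *: transpose f psi + transpose f chi.
Proof. exact: lip0_ext. Qed.

Lemma transpose_linear a f g psi :
  transpose (a *: f + g) psi = a *: transpose f psi + transpose g psi.
Proof. by apply: lip0_ext => x; exact: clin_linear. Qed.

Lemma transposeB f g psi : transpose (f - g) psi = transpose f psi - transpose g psi.
Proof. by apply: lip0_ext => x; exact: dualB. Qed.

Lemma slopeN (G : normedModType K) (f : lip0 x0 G) p : slope (- f) p = slope f p.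
Proof. by rewrite -scaleN1r slopeZ normrN normr1 real_part1 mul1r. Qed.

Lemma slope_transpose f psi (M : R) p :
  (forall v, rnorm (psi v : K^o) <= M * rnorm v) ->
  slope (transpose f psi) p <= M * slope f p.
Proof.
move=> psiM; rewrite /slope mulrA ler_wpM2r ?invr_ge0 ?mdist_ge0//=.
by rewrite -dualB.
Qed.

(** Hahn-Banach: the slope of f is attained by the transpose on the unit ball
    of the dual. *)
Lemma slope_norming f p : exists psi,
  (forall v, rnorm (psi v : K^o) <= 1 * rnorm v) /\
  slope f p <= slope (transpose f psi) p.
Proof.
have [psi [psi1 psiE]] := norming_functional (f p.1 - f p.2).
exists psi; split => [v|]; first by rewrite mul1r.
rewrite /slope ler_wpM2r ?invr_ge0 ?mdist_ge0//= -psiE dualB.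
exact: real_part_le_norm.
Qed.

(** A slope seminorm of psi \o f is the supremum of |psi| over a null sequence
    of scaled differences of f, hence controlled on a compact set. *)
Lemma transpose_continuous f :
  continuous (transpose f : dual_c F -> lip0_tau_gamma k x0).
Proof.
move=> psi A /nbhs_lc_shift/tau_gamma_slope_polar[alpha [p [[a0 ac] aA]]].
pose z n := of_real k (alpha n / mdist (p n).1 (p n).2) *: (f (p n).1 - f (p n).2).
have zE n : rnorm (z n) = alpha n * slope f (p n).
  rewrite rnorm_of_realZ ger0_norm; last by rewrite divr_ge0 ?mdist_ge0// ltW.
  by rewrite /slope mulrAC mulrA.
have [M M0 fM] := lip0_lipschitz f.
have z0 e : 0 < e -> \forall n \near \oo, rnorm (z n) <= e.
  move=> e0; have M1 : 0 < M + 1 by rewrite ltr_wpDl.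
  have /cvgrPdist_lt/(_ _ (divr_gt0 e0 M1)) := ac.
  apply: filterS => n; rewrite sub0r normrN gtr0_norm// ltr_pdivlMr// => aM.
  rewrite zE (le_trans _ (ltW aM))// ler_wpM2l// ?ltW//.
  have : slope f (p n) <= M by apply/(slope_leP _ _ M0); exact: fM.
  by move=> /le_lt_trans; apply; rewrite ltrDl.
have bz := @null_hull_balanced _ _ _ z.
apply/nbhs_dual_c; exists (null_hull z), 1; split => //.
- by split => //; [exact: null_hull_convex|exact: compact_null_hull].
- by apply: balanced0 => //; exists (z 0%N); exact: null_hull_mem.
move=> phi psiphi.
pose g : L := transpose f phi - transpose f psi.
have gE : (transpose f psi : L) + g = transpose f phi by rewrite addrC subrK.
suff : A ((transpose f psi : L) + g) by rewrite gE.
apply: aA => n; apply: ltW; apply: le_lt_trans (psiphi _ (null_hull_mem n)).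
have -> : psi (z n) - phi (z n) =
    of_real k (alpha n / mdist (p n).1 (p n).2) * - (g (p n).1 - g (p n).2).
  rewrite /z !dualZ -mulrBr; congr (_ * _); rewrite !dualB.
  rewrite [g (p n).1](_ : _ = phi (f (p n).1) - psi (f (p n).1))//.
  rewrite [g (p n).2](_ : _ = phi (f (p n).2) - psi (f (p n).2))//.
  by ring.
rewrite rnormM rnormN rnorm_of_real ger0_norm; last first.
  by rewrite divr_ge0 ?mdist_ge0// ltW.
by rewrite /slope mulrA mulrAC.
Qed.

Lemma transpose_clin f :
  (transpose f : dual_c F -> lip0_tau_gamma k x0)
    \in @clin_pred K (dual_c F) (lip0_tau_gamma k x0).
Proof.
apply/asboolP; split; last exact: transpose_continuous.
by move=> a psi chi; exact: transposeDZ.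
Qed.

Definition transpose_map (f : lip0_gamma_tau_gamma x0 F) : E := Clin (transpose_clin f).

Lemma transpose_map_linear : linear transpose_map.
Proof.
by move=> a f g; apply: val_inj; apply/funext => psi; exact: transpose_linear.
Qed.

Lemma transpose_map_inj : injective transpose_map.
Proof.
move=> f g fg; apply: lip0_ext => x; apply/eqP; rewrite -subr_eq0; apply/eqP.
apply: dual_separates => psi; rewrite dualB.
have : transpose f psi x = transpose g psi x.
  by have -> : transpose f psi = transpose_map f psi by []; rewrite fg.
by move=> /= ->; rewrite subrr.
Qed.

Lemma transpose_map_continuous : continuous transpose_map.
Proof.
move=> f A /nbhs_eps_product[M [U [M0 BU UA]]].
have [alpha [p [[a0 ac] aU]]] := tau_gamma_slope_polar (nbhs_lc_base BU).
apply/nbhs_lc_shift.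
have aw : null_weights (fun n => M * alpha n).
  split=> [n|]; first exact: mulr_gt0.
  by rewrite -(mulr0 M); apply: cvgM => //; exact: cvg_cst.
apply: (@filterS _ (nbhs (0 : lip0_gamma_tau_gamma x0 F)) _ _ _ _
  (slope_polar_nbhs p aw)) => u uP.
apply: UA => psi psiM; apply: aU => n.
have -> : (transpose_map f psi : L) - transpose_map (f + u) psi = - transpose u psi.
  by rewrite -opprB -transposeB addrAC subrr add0r.
rewrite slopeN; apply: le_trans (uP n).
by rewrite (mulrC M) -mulrA ler_pM2l//; exact: slope_transpose.
Qed.

Lemma compact_bounded_rnorm (C : set F) : compact C ->
  exists2 D : R, 0 < D & forall c, C c -> rnorm c <= D.
Proof.
move=> kC; have cn : continuous (fun x : F => rnorm x : R^o).
  move=> x; apply/cvgrPdist_lt => e e0; apply/nbhs_rnorm; exists e => // y yx.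
  have := rnormD (y - x) x; have := rnormD (x - y) y.
  by rewrite !subrK (rnormB x) ltr_norml; lra.
have [[c Cc]|C0] := pselect (C !=set0); last first.
  by exists 1 => // c Cc; exfalso; apply: C0; exists c.
have [||d _ dmax] := @compact_EVT_max F R (@rnorm _ _ _) C _ kC.
- by exists c.
- exact: continuous_subspaceT.
exists (rnorm d + 1) => [|a Ca]; first by rewrite ltr_wpDl ?rnorm_ge0.
by rewrite (le_trans (dmax a (mem_set Ca)))// lerDl.
Qed.

Lemma eps_product_compact (T : E) (A : set L) :
  nbhs (0 : lip0_tau_gamma k x0) A ->
  exists C e, [/\ convex_balanced_compact C, C 0, 0 < e &
    forall psi, (forall c, C c -> rnorm (psi c : K^o) < e) -> A (T psi)].
Proof.
move=> nA; have T0 : T 0 = 0 by exact: (linear0 (clin_fun T)).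
have := @clin_continuous _ _ _ T 0 A; rewrite T0 => /(_ nA) /nbhs_dual_c.
move=> [C [e [kC C0 e0 CeA]]]; exists C, e; split => // psi psie.
by apply: CeA => c Cc; rewrite [X in rnorm X](_ : _ = - psi c) ?rnormN ?psie// sub0r.
Qed.

Lemma eps_product_value (T : E) (x : X) :
  exists v : F, forall psi, (T psi : L) x = psi v.
Proof.
(* slopes at the constant pair (x, x0) bound the value at x; the + 1 keeps the
   weights positive when x = x0 *)
pose d := mdist x x0 + 1.
have d0 : 0 < d by rewrite ltr_wpDl ?mdist_ge0.
have aw : null_weights (fun n => d * harmonic n).
  split=> [n|]; first by rewrite mulr_gt0// harmonic_gt0.
  by rewrite -(mulr0 d); apply: cvgM; [exact: cvg_cst|exact: cvg_harmonic].
have [C [e [kC C0 e0 CeT]]] := eps_product_compact T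
  (slope_polar_tau_gamma (fun=> (x, x0)) aw).
have Tx psi : (forall c, C c -> rnorm (psi c : K^o) < e) ->
    rnorm ((T psi : L) x) <= 1.
  move=> /CeT/(_ 0%N); rewrite /harmonic /= invr1 mulr1 => ds.
  have := (slope_leP (T psi : L) (x, x0) (slope_ge0 _ _)).1 (lexx _).
  rewrite /= lip0_base subr0 => /le_trans; apply; apply: le_trans ds.
  by rewrite mulrC ler_wpM2r ?slope_ge0// lerDl.
have TL a psi chi y : (T (a *: psi + chi) : L) y = a * (T psi : L) y + (T chi : L) y.
  by have -> : T (a *: psi + chi) = a *: T psi + T chi by exact: clin_linear.
have TZ a psi y : (T (a *: psi) : L) y = a * (T psi : L) y.
  have T0 : T 0 = 0 by exact: (linear0 (clin_fun T)).
  by have := TL a psi 0 y; rewrite T0 !addr0.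
(* the factor e / 2 turns the bound by 1 for |psi| < e on C into a bound of
   the value by the supremum of |psi| on C *)
pose phi psi : K^o := of_real k (e / 2) * (T psi : L) x.
have phi_linear : linear (phi : dual F -> K^o).
  by move=> a psi chi; rewrite /phi TL mulrDr mulrCA.
have [|c Cc phiE] := representation phi_linear kC C0.
  move=> psi M M0 psiM; have e2 : 0 < e / 2 by rewrite divr_gt0.
  pose t := e / 2 / M; have t0 : 0 < t by rewrite divr_gt0.
  have tM : t * M = e / 2 by rewrite divfK// gt_eqF.
  rewrite /phi rnormM rnorm_of_real gtr0_norm// -tM mulrAC ger_pMl//.
  have <- : rnorm ((T (of_real k t *: psi) : L) x) = t * rnorm ((T psi : L) x).
    by rewrite TZ rnormM rnorm_of_real gtr0_norm.
  apply: Tx => c Cc; apply: (@le_lt_trans _ _ (t * M)); last by rewrite tM; lra.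
  rewrite [(_ *: psi) c](_ : _ = of_real k t * psi c)//.
  by rewrite rnormM rnorm_of_real gtr0_norm// ler_pM2l// psiM.
exists (of_real k (2 / e) *: c) => psi.
rewrite dualZ -phiE /phi mulrA -of_realM (_ : 2 / e * (e / 2) = 1) ?of_real1 ?mul1r//.
by field; rewrite gt_eqF.
Qed.

(** The values of T give a map f; were it not Lipschitz, weights 2^-n along
    pairs with slopes above 4^n would define a seminorm that is continuous for
    the mixed topology and unbounded on the image of a ball of F'. *)
Lemma transpose_map_surj (T : E) : exists f, transpose_map f = T.
Proof.
have /choice[f fE] := eps_product_value T.
have f0 : f x0 = 0.
  by apply: dual_separates => psi; rewrite -fE lip0_base.
suff [M fM] : exists M : R, forall x y, rnorm (f x - f y) <= M * mdist x y.
  have fP : f \in lip0_pred x0 F by apply/asboolP; split => //; exists M.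
  exists (Lip0 fP); apply: val_inj; apply/funext => psi.
  by apply: lip0_ext => x; exact/esym/fE.
apply: contrapT => nlip.
have /choice[p pP] : forall n : nat, exists p : X * X,
    4 ^+ n * mdist p.1 p.2 < rnorm (f p.1 - f p.2).
  move=> n; apply: contrapT => np; apply: nlip; exists (4 ^+ n) => x y.
  by rewrite leNgt; apply/negP => xy; apply: np; exists (x, y).
have aw : null_weights (fun n => (2^-1 : R) ^+ n).
  split=> [n|]; first by rewrite exprn_gt0 ?invr_gt0.
  by apply: cvg_expr; rewrite ger0_norm; lra.
have [C [e [kC C0 e0 CeT]]] := eps_product_compact T (slope_polar_tau_gamma p aw).
have [D D0 CD] : exists2 D : R, 0 < D & forall c, C c -> rnorm c <= D.
  by apply: compact_bounded_rnorm; case: kC.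
(* eta shrinks the unit ball of the dual into the functionals below e on C *)
pose eta := e / (2 * D); have eta0 : 0 < eta by rewrite divr_gt0// mulr_gt0.
have [n etan] := exp2_unbounded eta^-1.
have [psi [psi1 psiE]] := norming_functional (f (p n).1 - f (p n).2).
have /CeT/(_ n) : forall c, C c -> rnorm ((of_real k eta *: psi) c : K^o) < e.
  move=> c Cc; rewrite [(_ *: psi) c](_ : _ = of_real k eta * psi c)//.
  rewrite rnormM rnorm_of_real gtr0_norm//.
  apply: (@le_lt_trans _ _ (eta * D)).
    by rewrite ler_wpM2l ?(ltW eta0)// (le_trans (psi1 c))// CD.
  by rewrite (_ : eta * D = e / 2); [lra|rewrite /eta; field; rewrite gt_eqF].
have p2 : 0 < 2 ^+ n :> R by rewrite exprn_gt0.
rewrite exprVn ler_pdivrMl// mulr1 => /(slope_leP _ _ (ltW p2)).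
rewrite !fE.
rewrite [X in rnorm X](_ : _ = of_real k eta * psi (f (p n).1 - f (p n).2));
  last first.
  by rewrite dualB mulrBr.
rewrite rnormM rnorm_of_real gtr0_norm// => h.
have {}h : eta * rnorm (f (p n).1 - f (p n).2) <= 2 ^+ n * mdist (p n).1 (p n).2.
  by apply: le_trans h; rewrite ler_pM2l// -psiE; exact: real_part_le_norm.
have := pP n; set m := mdist _ _ in h *; set r := rnorm _ in h * => mr.
have m0 : 0 <= m by exact: mdist_ge0.
have one : 1 <= eta * 2 ^+ n by rewrite -ler_pdivrMl// mulr1.
have : eta * (4 ^+ n * m) < eta * r by rewrite ltr_pM2l.
have -> : (4 : R) ^+ n = 2 ^+ n * 2 ^+ n by rewrite -exprMn; congr (_ ^+ _); ring.
have : 2 ^+ n * m <= (eta * 2 ^+ n) * (2 ^+ n * m).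
  by rewrite ler_peMl// mulr_ge0// ltW.
by move: h; rewrite !mulrA; lra.
Qed.

(** Norming functionals bound slopes of S T - S T0 by those of T psi - T0 psi,
    uniformly on the unit ball of the dual. *)
Lemma transpose_map_inverse_continuous (S : E -> lip0_gamma_tau_gamma x0 F) :
  cancel S transpose_map -> continuous S.
Proof.
move=> SK T0 A /nbhs_slope_polars[n [alpha [p [aw apA]]]].
suff near_polar i : nbhs T0 [set T : E |
    slope_polar (alpha i) (p i) ((S T : lip0 x0 F) - S T0)].
  have := @filter_forall _ _ _ (nbhs T0) (@nbhs_filter _ T0) near_polar.
  by move=> h; apply: (@filterS _ (nbhs T0) _ _ _ _ h) => T; exact: apA.
have [U BU Ua] := @slope_polar_tau_gamma R k X x0 _ (p i) (aw i).
apply/nbhs_eps_product; exists 1, U; split => // T TU m.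
have [psi [psi1 psiE]] := slope_norming ((S T : lip0 x0 F) - S T0) (p i m).
apply: (le_trans (ler_wpM2l (ltW ((aw i).1 m)) psiE)).
have := Ua _ (TU psi psi1) m; rewrite add0r.
rewrite -{1}(SK T0) -{1}(SK T) -slopeN opprB transposeB.
exact.
Qed.

End transpose_isomorphism.

Theorem theorem4p3 (R : realType) (k : scalar_kind) (X : metricType R) (x0 : X)
    (F : completeNormedModType (scalar_field R k)) :
  exists Phi : lip0_gamma_tau_gamma x0 F -> eps_product (lip0_tau_gamma k x0) F,
    (forall (f : lip0 x0 F) (psi : dual F), Phi f psi = transpose f psi) /\
    topological_isomorphism Phi.
Proof.
exists (@transpose_map R k X x0 F); split => //; split.
  exact: transpose_map_linear.
have /choice[S SK] := @transpose_map_surj R k X x0 F.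
exists S; split => //.
- by move=> f; apply: transpose_map_inj; rewrite SK.
- exact: transpose_map_continuous.
- exact: transpose_map_inverse_continuous.
Qed.
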